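(* Let $\tilde f:\mathbb{R}^2\to\mathbb{R}^2$ be a homeomorphism isotopic to the identity, commuting with $T(x,y)=(x+1,y)$, and satisfying hypotheses (H1), (H2), (H3). Let $\tilde A=\tilde A_0\cup\tilde A_1$. Then $0\in\rho_{\Theta(\tilde A)}(\tilde f)$.
   Context: Let $\tilde f$ be a homeomorphism of $\mathbb{R}^2$ isotopic to the identity and commuting with $T(x,y)=(x+1,y)$; $p_1$ is the first coordinate projection. For a horizontal line $\Gamma$, $U^+_\Gamma$ and $U^-_\Gamma$ denote the open half-planes above and below $\Gamma$. Hypotheses: (H1) $\Gamma_0,\Gamma_1,\Gamma_2$ are horizontal lines with $\Gamma_0\subset U^+_{\Gamma_1}$, $\Gamma_1\subset U^+_{\Gamma_2}$, and $\tilde f(\Gamma_j)\subset U^-_{\Gamma_j}$ for $j=0,1,2$; (H2) $\tilde f^n(\Gamma_0)\cap\Gamma_2\ne\emptyset$ for every integer $n\ge1$; (H3) for $i\in\{0,1\}$, letting $\tilde A_i$ be the closed band between $\Gamma_i$ and $\Gamma_{i+1}$, the sets $\Theta(\tilde A_0),\Theta(\tilde A_1)$ are non-empty and $\rho_{\Theta(\tilde A_0)}(\tilde f)\subset(0,+\infty)$, $\rho_{\Theta(\tilde A_1)}(\tilde f)\subset(-\infty,0)$. Here $\Theta(\tilde E)=\{x\in\tilde E:\tilde f^n(x)\in\tilde E\ \forall n\in\mathbb{Z}\}$, and for a closed $T$-invariant set $\tilde E$ contained in a horizontal band, $\rho_{\tilde E}(\tilde f)=\bigcap_{m\ge1}\mathrm{Cl}\big(\bigcup_{n\ge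 m}\{\frac1n(p_1(\tilde f^n(\tilde z))-p_1(\tilde z)): \tilde z\in\tilde E,\ \tilde f^n(\tilde z)\in\tilde E\}\big)$, closure in $\overline{\mathbb{R}}=\mathbb{R}\cup\{\pm\infty\}$. *)

(* Defs.v *)
From Stdlib Require Import Reals Lra.
Open Scope R_scope.

Definition pt := (R * R)%type.

(* sup-distance on R^2 (induces the usual topology) *)
Definition dist2 (p q : pt) : R :=
  Rmax (Rabs (fst p - fst q)) (Rabs (snd p - snd q)).

Definition cont2 (f : pt -> pt) : Prop :=
  forall p eps, 0 < eps -> exists d, 0 < d /\
    forall q, dist2 p q < d -> dist2 (f p) (f q) < eps.

Definition homeo (f : pt -> pt) : Prop :=
  cont2 f /\ exists g : pt -> pt,
    cont2 g /\ (forall p, g (f p) = p) /\ (forall p, f (g p) = p).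

Definition isotopic_to_id (f : pt -> pt) : Prop :=
  exists H : R -> pt -> pt,
    (forall t, 0 <= t <= 1 -> homeo (H t)) /\
    (forall t p eps, 0 <= t <= 1 -> 0 < eps -> exists d, 0 < d /\
        forall s q, 0 <= s <= 1 -> Rabs (s - t) < d -> dist2 p q < d ->
          dist2 (H t p) (H s q) < eps) /\
    (forall p, H 0 p = p) /\
    (forall p, H 1 p = f p).

Definition Ttr (p : pt) : pt := (fst p + 1, snd p).

Definition commutes_with_T (f : pt -> pt) : Prop :=
  forall p, f (Ttr p) = Ttr (f p).

Fixpoint iter (n : nat) (f : pt -> pt) (p : pt) : pt :=
  match n with O => p | S k => f (iter k f p) end.

(* Theta(E) = { x in E : f^n(x) in E for all integers n }.
   For a bijection f, f^{-n}(x) is the unique y with f^n(y) = x. *)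
Definition Theta (f : pt -> pt) (E : pt -> Prop) (x : pt) : Prop :=
  E x /\ (forall n : nat, E (iter n f x)) /\
  (forall (n : nat) (y : pt), iter n f y = x -> E y).

Definition band (a b : R) (p : pt) : Prop := a <= snd p <= b.

Inductive Rbar := Fin (r : R) | PInf | MInf.

Definition in_closure_tail (f : pt -> pt) (E : pt -> Prop) (m : nat) (x : Rbar) : Prop :=
  let S := fun v : R => exists (n : nat) (z : pt),
      (m <= n)%nat /\ E z /\ E (iter n f z) /\
      v = (fst (iter n f z) - fst z) / INR n in
  match x with
  | Fin r => forall eps, 0 < eps -> exists v, S v /\ Rabs (v - r) < eps
  | PInf => forall M, exists v, S v /\ M < v
  | MInf => forall M, exists v, S v /\ v < M
  end.

Definition rho_in (f : pt -> pt) (E : pt -> Prop) (x : Rbar) : Prop :=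
  forall m : nat, (1 <= m)%nat -> in_closure_tail f E m x.

(* Main.v *)
From Stdlib Require Import Reals Lra Lia ZArith Classical ClassicalEpsilon Bool.
Require Import Defs.
Open Scope R_scope.

(** Write [Gamma_j] for the line of height [c_j].  Since [f] pushes each [Gamma_j] down,
    an orbit crosses it at most once.  If there is an orbit of [Theta(A)] whose past lies
    in [A_0] and whose future lies in [A_1], its abscissa increases linearly in the past
    and decreases linearly in the future, so it has arbitrarily long segments with bounded
    horizontal displacement, and [0] is a rotation number.

    Otherwise, by compactness, for some [N] no orbit segment of length [2N] in [A]
    crosses [Gamma_1] at its middle time.  Then the set of points of [A] staying in [A] for
    [2N] steps is split by [Gamma_1] at time [N] into two parts [slow0] and [slow1], which
    no path can join.  Take [p] in [Theta(A_0)] and [q] in [Theta(A_1)].  Each can be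
    joined to [Gamma_0] inside the part of the slow set containing it, and to [Gamma_2]
    inside the [2N]-th image of that part.  The resulting curves crossing [A] through [p]
    and through [q] are disjoint, hence ordered from left to right, and this order is
    preserved by [f].  The slow pieces have bounded width, because (H2) provides a barrier
    from [Gamma_0] to [Gamma_2], so [p] cannot drift to the right of [q] if it starts on
    the left: this contradicts the signs of the rotation numbers. *)

Lemma Rabs_le_bounds x a : Rabs x <= a -> - a <= x <= a.
Proof.
  intros H. pose proof (Rle_abs x). pose proof (Rle_abs (- x)).
  rewrite Rabs_Ropp in *; lra.
Qed.

Lemma choice (A B : Type) (R : A -> B -> Prop) :
  (forall x, exists y, R x y) -> exists h : A -> B, forall x, R x (h x).
Proof.
  intros H. exists (fun x => proj1_sig (constructive_indefinite_description _ (H x))).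
  intros x. apply proj2_sig.
Qed.

(** * Parity on a grid *)

Section GridParity.
Variables s u : nat -> nat -> bool.

(** With [s] and [u] the signs of the two coordinates of a vector field on the grid, this detects an
    edge on which the vector passes through the half-axis where the first coordinate vanishes and
    the second is positive. Its sum along a loop plays the role of the winding number modulo 2. *)
Definition cross (i j i' j' : nat) : bool :=
  xorb (s i j) (s i' j') && (u i j && u i' j').

Definition mixed (a b c : bool) : bool := xorb a b || xorb b c.

Definition full (i j i' j' i'' j'' : nat) : bool :=
  mixed (s i j) (s i' j') (s i'' j'') && mixed (u i j) (u i' j') (u i'' j'').

Fixpoint row (j k : nat) : bool :=
  match k with O => false | S i => xorb (row j i) (cross i j (S i) j) end.

Fixpoint col (i k : nat) : bool :=
  match k with O => false | S j => xorb (col i j) (cross i j i (S j)) end.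

(** On a triangle that is not [full], one of the two signs is constant: if it is [s] or [u] being
    false, every [cross] vanishes; if it is [u] being true, [cross] is the coboundary of [s]. So
    [cross] is a cocycle away from full triangles. *)
Lemma triangle_cross i j i' j' i'' j'' :
  full i j i' j' i'' j'' = false ->
  cross i j i'' j'' = xorb (cross i j i' j') (cross i' j' i'' j'').
Proof.
  unfold full, mixed, cross.
  destruct (s i j), (s i' j'), (s i'' j''), (u i j), (u i' j'), (u i'' j'');
    simpl; congruence.
Qed.

Lemma square_cross i j :
  full i j (S i) j (S i) (S j) = false ->
  full i j i (S j) (S i) (S j) = false ->
  xorb (cross i j (S i) j) (cross (S i) j (S i) (S j)) =
  xorb (cross i j i (S j)) (cross i (S j) (S i) (S j)).
Proof.
  intros H1 H2; apply triangle_cross in H1; apply triangle_cross in H2; congruence.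
Qed.

(** A discrete Stokes formula: the cocycle relation is summed first over the squares of a strip,
    then over the strips. *)
Lemma grid_parity m n :
  (forall i j, (i < m)%nat -> (j < n)%nat ->
     full i j (S i) j (S i) (S j) = false /\ full i j i (S j) (S i) (S j) = false) ->
  xorb (row 0 m) (col m n) = xorb (col 0 n) (row n m).
Proof.
  intros H.
  assert (A : forall j k, (j < n)%nat -> (k <= m)%nat ->
     xorb (row j k) (cross k j k (S j)) = xorb (cross 0 j 0 (S j)) (row (S j) k)).
  { intros j k Hj; induction k as [|k IH]; intros Hk; simpl.
    - now destruct (cross 0 j 0 (S j)).
    - assert (Hk' : (k < m)%nat) by lia.
      destruct (H k j Hk' Hj) as [H1 H2].
      pose proof (square_cross _ _ H1 H2) as Q.
      assert (IH' := IH (Nat.lt_le_incl _ _ Hk')). revert Q IH'.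
      destruct (row j k), (cross k j (S k) j), (cross (S k) j (S k) (S j)),
        (cross 0 j 0 (S j)), (row (S j) k), (cross k (S j) (S k) (S j)),
        (cross k j k (S j)); simpl; congruence. }
  assert (B : forall k, (k <= n)%nat ->
     xorb (row 0 m) (col m k) = xorb (col 0 k) (row k m)).
  { induction k as [|k IH]; intros Hk; simpl.
    - now destruct (row 0 m).
    - assert (Hk' : (k < n)%nat) by lia.
      pose proof (A k m Hk' (Nat.le_refl _)) as Q.
      assert (IH' := IH (Nat.lt_le_incl _ _ Hk')). revert Q IH'.
      destruct (row 0 m), (col m k), (cross m k m (S k)), (col 0 k),
        (cross 0 k 0 (S k)), (row (S k) m), (row k m); simpl; congruence. }
  apply B; lia.
Qed.

(** Otherwise [grid_parity] applies, but the boundary sum is odd: the sides [i = 0] and [j = n]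
    contribute nothing, since [u] is false there, and along the two other sides [s] goes from false
    to true. The conditions on [s 1 0] and [s m (pred n)] keep the changes of [s] away from the two
    edges on which [u] changes. *)
Lemma full_cell m n :
  (1 <= m)%nat -> (1 <= n)%nat ->
  s 0 0 = false -> s 1 0 = false -> s m n = true -> s m (pred n) = true ->
  (forall j, u 0%nat j = false) -> (forall i, u i n = false) ->
  (forall i, (1 <= i <= m)%nat -> u i 0%nat = true) ->
  (forall j, (j < n)%nat -> u m j = true) ->
  exists i j, (i < m)%nat /\ (j < n)%nat /\
    (full i j (S i) j (S i) (S j) = true \/ full i j i (S j) (S i) (S j) = true).
Proof.
  intros Hm Hn s00 s10 smn smp u0 un ui um.
  apply NNPP; intros C.
  assert (G : xorb (row 0 m) (col m n) = xorb (col 0 n) (row n m)).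
  { apply grid_parity; intros i j Hi Hj; split; apply not_true_iff_false;
      intros E; apply C; exists i, j; auto. }
  assert (C0 : forall k, col 0 k = false).
  { induction k; simpl; trivial. rewrite IHk. unfold cross; rewrite !u0.
    destruct (s 0%nat k), (s 0%nat (S k)); reflexivity. }
  assert (Rn : forall k, row n k = false).
  { induction k; simpl; trivial. rewrite IHk. unfold cross; rewrite !un.
    destruct (s k n), (s (S k) n); reflexivity. }
  assert (R0 : forall k, (k <= m)%nat -> row 0 k = s k 0%nat).
  { induction k as [|k IH]; intros Hk; simpl; auto.
    rewrite IH by lia. unfold cross. rewrite (ui (S k)) by lia.
    destruct k as [|k]; [rewrite u0, s00, s10; reflexivity|].
    rewrite (ui (S k)) by lia.
    destruct (s (S k) 0%nat), (s (S (S k)) 0%nat); reflexivity. }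
  assert (Cm : forall k, (k < n)%nat -> col m k = xorb (s m 0%nat) (s m k)).
  { induction k as [|k IH]; intros Hk; simpl.
    - now destruct (s m 0%nat).
    - rewrite IH by lia. unfold cross. rewrite !um by lia.
      destruct (s m 0%nat), (s m k), (s m (S k)); reflexivity. }
  rewrite C0, Rn, R0 in G by lia.
  destruct n as [|n]; [lia|]. simpl in G, smp.
  rewrite Cm in G by lia. unfold cross in G.
  rewrite un, smn, smp in G. destruct (s m 0%nat), (u m n); discriminate.
Qed.
End GridParity.

Definition nonneg (x : R) : bool := if Rle_dec 0 x then true else false.

Lemma grid_small_value (F1 F2 : nat -> nat -> R) (n : nat) (e : R) :
  (1 <= n)%nat -> 0 < e ->
  (forall i j i' j', (i <= i' <= S i)%nat -> (j <= j' <= S j)%nat ->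
     (i' <= n)%nat -> (j' <= n)%nat ->
     Rabs (F1 i j - F1 i' j') <= e /\ Rabs (F2 i j - F2 i' j') <= e) ->
  F1 0%nat 0%nat < - e -> e < F1 n n ->
  (forall i, (i <= n)%nat -> Rabs (F1 i 0%nat) <= e -> 0 <= F2 i 0%nat) ->
  (forall j, (j <= n)%nat -> Rabs (F1 n j) <= e -> 0 <= F2 n j) ->
  (forall j, (j <= n)%nat -> Rabs (F1 0%nat j) <= e -> F2 0%nat j <= 0) ->
  (forall i, (i <= n)%nat -> Rabs (F1 i n) <= e -> F2 i n <= 0) ->
  exists i j, (i <= n)%nat /\ (j <= n)%nat /\ Rabs (F1 i j) <= e /\ Rabs (F2 i j) <= e.
Proof.
  intros Hn He Hstep H00 Hnn Ha Hb Hc Hd.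
  set (s := fun i j => nonneg (F1 i j)).
  (* On the boundary [u] is forced to the values that [full_cell] asks for. By the boundary
     hypotheses this agrees with the sign of [F2] wherever [F1] is small. *)
  set (u := fun i j => if Nat.eqb i 0 || Nat.eqb j n then false
                       else if Nat.eqb j 0 || Nat.eqb i n then true
                       else nonneg (F2 i j)).
  assert (st : forall i j, s i j = true -> 0 <= F1 i j).
  { intros i j; unfold s, nonneg; destruct (Rle_dec 0 (F1 i j)); congruence. }
  assert (sf : forall i j, s i j = false -> F1 i j < 0).
  { intros i j; unfold s, nonneg; destruct (Rle_dec 0 (F1 i j)); [congruence|intros; lra]. }
  assert (ut : forall i j, (i <= n)%nat -> (j <= n)%nat -> Rabs (F1 i j) <= e ->
             u i j = true -> 0 <= F2 i j).
  { intros i j Hi Hj HF; unfold u, nonneg.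
    destruct (Nat.eqb_spec i 0), (Nat.eqb_spec j n), (Nat.eqb_spec j 0), (Nat.eqb_spec i n),
      (Rle_dec 0 (F2 i j)); simpl; try congruence; intros _; subst; auto. }
  assert (uf : forall i j, (i <= n)%nat -> (j <= n)%nat -> Rabs (F1 i j) <= e ->
             u i j = false -> F2 i j <= 0).
  { intros i j Hi Hj HF; unfold u, nonneg.
    destruct (Nat.eqb_spec i 0), (Nat.eqb_spec j n), (Nat.eqb_spec j 0), (Nat.eqb_spec i n),
      (Rle_dec 0 (F2 i j)); simpl; try congruence; intros _; subst; auto; lra. }
  (* In a full triangle the mixed signs of [s] make [F1] small at all three vertices; there [u] is a
     true sign of [F2], and since it is mixed too, [F2] is small. *)
  assert (K : forall i j i' j' i'' j'',
     (i <= i' <= S i)%nat -> (j <= j' <= S j)%nat ->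
     (i' <= i'' <= S i')%nat -> (j' <= j'' <= S j')%nat ->
     (i'' <= S i)%nat -> (j'' <= S j)%nat -> (i'' <= n)%nat -> (j'' <= n)%nat ->
     full s u i j i' j' i'' j'' = true -> Rabs (F1 i j) <= e /\ Rabs (F2 i j) <= e).
  { intros i j i' j' i'' j'' h1 h2 h3 h4 h5 h6 h7 h8.
    destruct (Hstep i j i' j') as [A1 A2]; try lia.
    destruct (Hstep i j i'' j'') as [B1 B2]; try lia.
    destruct (Hstep i' j' i'' j'') as [C1 C2]; try lia.
    apply Rabs_le_bounds in A1, A2, B1, B2, C1, C2.
    unfold full, mixed; intros E; apply andb_true_iff in E; destruct E as [E1 E2].
    assert (F : (Rabs (F1 i j) <= e /\ Rabs (F1 i' j') <= e) /\ Rabs (F1 i'' j'') <= e).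
    { destruct (s i j) eqn:s1, (s i' j') eqn:s2, (s i'' j'') eqn:s3; try discriminate;
      repeat match goal with
      | H : s _ _ = true |- _ => apply st in H
      | H : s _ _ = false |- _ => apply sf in H end;
      repeat split; apply Rabs_le; lra. }
    destruct F as [[G1 G2] G3]. split; trivial.
    destruct (u i j) eqn:s1, (u i' j') eqn:s2, (u i'' j'') eqn:s3; try discriminate;
      repeat match goal with
      | H : u _ _ = true |- _ => apply ut in H; [|lia|lia|assumption]
      | H : u _ _ = false |- _ => apply uf in H; [|lia|lia|assumption] end;
      apply Rabs_le; lra. }
  destruct (full_cell s u n n) as (i & j & Hi & Hj & Hf); trivial.
  - unfold s, nonneg; destruct (Rle_dec 0 (F1 0%nat 0%nat)); trivial; lra.
  - destruct (Hstep 0 0 1 0)%nat as [A _]; try lia. apply Rabs_le_bounds in A.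
    unfold s, nonneg; destruct (Rle_dec 0 (F1 1%nat 0%nat)); trivial; lra.
  - unfold s, nonneg; destruct (Rle_dec 0 (F1 n n)); trivial; lra.
  - destruct (Hstep n (pred n) n n)%nat as [A _]; try lia. apply Rabs_le_bounds in A.
    unfold s, nonneg; destruct (Rle_dec 0 (F1 n (pred n))); trivial; lra.
  - intros i; unfold u. rewrite (Nat.eqb_refl n), orb_true_r; reflexivity.
  - intros i Hi; unfold u. rewrite Nat.eqb_refl.
    destruct (Nat.eqb_spec i 0), (Nat.eqb_spec 0 n); try lia; reflexivity.
  - intros j Hj; unfold u. rewrite Nat.eqb_refl, orb_true_r.
    destruct (Nat.eqb_spec n 0), (Nat.eqb_spec j n); try lia; reflexivity.
  - exists i, j. split; [lia|split; [lia|]].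
    destruct Hf as [Hf|Hf]; [apply (K i j (S i) j (S i) (S j))|apply (K i j i (S j) (S i) (S j))];
      trivial; lia.
Qed.

(** * Crossing paths *)

Lemma dist2_lt p q e :
  dist2 p q < e <-> Rabs (fst p - fst q) < e /\ Rabs (snd p - snd q) < e.
Proof. unfold dist2; split; [apply Rmax_Rlt|intros [? ?]; now apply Rmax_lub_lt]. Qed.

Lemma continuity_intro (h : R -> R) :
  (forall t e, 0 < e -> exists d, 0 < d /\ forall s, Rabs (s - t) < d -> Rabs (h s - h t) < e) ->
  continuity h.
Proof.
  intros H t e He. destruct (H t e He) as (d & Hd & K).
  exists d; split; trivial. intros s [_ Hs]. now apply K.
Qed.

Lemma continuity_elim (h : R -> R) t e :
  continuity h -> 0 < e ->
  exists d, 0 < d /\ forall s, Rabs (s - t) < d -> Rabs (h s - h t) < e.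
Proof.
  intros H He. destruct (H t e He) as (d & Hd & K). exists d; split; trivial.
  intros s Hs. destruct (Req_dec t s) as [->|Hn].
  - unfold Rminus; rewrite Rplus_opp_r, Rabs_R0; trivial.
  - apply K. repeat split; trivial.
Qed.

Definition path (c : R -> pt) : Prop :=
  continuity (fun t => fst (c t)) /\ continuity (fun t => snd (c t)).

Lemma path_near c t e :
  path c -> 0 < e -> exists d, 0 < d /\ forall s, Rabs (s - t) < d -> dist2 (c t) (c s) < e.
Proof.
  intros [H1 H2] He.
  destruct (continuity_elim _ t e H1 He) as (d1 & P1 & K1).
  destruct (continuity_elim _ t e H2 He) as (d2 & P2 & K2).
  exists (Rmin d1 d2); split; [now apply Rmin_glb_lt|].
  intros s Hs. apply dist2_lt; rewrite (Rabs_minus_sym (fst _)), (Rabs_minus_sym (snd _)).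
  pose proof (Rmin_l d1 d2); pose proof (Rmin_r d1 d2).
  split; [apply K1|apply K2]; lra.
Qed.

Lemma path_comp f c : cont2 f -> path c -> path (fun t => f (c t)).
Proof.
  intros Hf Hc.
  assert (H : forall t e, 0 < e -> exists d, 0 < d /\
            forall s, Rabs (s - t) < d -> dist2 (f (c t)) (f (c s)) < e).
  { intros t e He. destruct (Hf (c t) e He) as (d & Hd & K).
    destruct (path_near c t d Hc Hd) as (d' & Hd' & K'). exists d'; auto. }
  split; apply continuity_intro; intros t e He; destruct (H t e He) as (d & Hd & K);
    exists d; split; trivial; intros s Hs; apply K, dist2_lt in Hs;
    rewrite Rabs_minus_sym; tauto.
Qed.

(** * Cluster points in rectangles and uniform continuity *)

Lemma adherent_subsequence (u : nat -> R) a b :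
  (forall n, a <= u n <= b) ->
  exists l, a <= l <= b /\
    forall e N, 0 < e -> exists n, (N <= n)%nat /\ Rabs (l - u n) < e.
Proof.
  intros H.
  destruct (Bolzano_Weierstrass u _ (compact_P3 a b) H) as [l Hl].
  assert (K : forall e N, 0 < e -> exists n, (N <= n)%nat /\ Rabs (l - u n) < e).
  { intros e N He. destruct (Hl (disc l (mkposreal e He)) N) as (n & Hn & D).
    - exists (mkposreal e He). intros x Hx; exact Hx.
    - exists n; split; trivial. unfold disc in D; simpl in D.
      now rewrite Rabs_minus_sym. }
  exists l; split; trivial. split.
  - destruct (Rle_or_lt a l) as [|Hlt]; trivial.
    destruct (K (a - l) O) as (n & _ & D); [lra|].
    specialize (H n). apply Rabs_def2 in D; lra.
  - destruct (Rle_or_lt l b) as [|Hlt]; trivial.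
    destruct (K (l - b) O) as (n & _ & D); [lra|].
    specialize (H n). apply Rabs_def2 in D; lra.
Qed.

(** Cluster points replace convergent subsequences: closed conditions that hold from some index on
    pass to them. *)
Definition adherent (u : nat -> pt) (z : pt) : Prop :=
  forall e N, 0 < e -> exists n, (N <= n)%nat /\ dist2 z (u n) < e.

Lemma inv_INR_small e : 0 < e -> exists N, forall n, (N <= n)%nat -> / (INR n + 1) < e.
Proof.
  intros He. destruct (archimed_cor1 e He) as (N & HN & HN'). exists N. intros n Hn.
  apply Rle_lt_trans with (/ INR N); trivial.
  apply Rinv_le_contravar; [now apply lt_0_INR|]. apply le_INR in Hn; lra.
Qed.

Lemma rectangle_adherent (u : nat -> pt) a b c d :
  (forall n, a <= fst (u n) <= b) -> (forall n, c <= snd (u n) <= d) ->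
  exists z, a <= fst z <= b /\ c <= snd z <= d /\ adherent u z.
Proof.
  intros H1 H2.
  destruct (adherent_subsequence _ a b H1) as (x & Hx & Kx).
  destruct (choice _ _ (fun n k => (n <= k)%nat /\ Rabs (x - fst (u k)) < / (INR n + 1)))
    as [phi Hphi].
  { intros n. apply Kx. apply Rinv_0_lt_compat. pose proof (pos_INR n); lra. }
  destruct (adherent_subsequence (fun n => snd (u (phi n))) c d) as (y & Hy & Ky); [auto|].
  exists (x, y); simpl. repeat split; try lra.
  intros e N He. destruct (inv_INR_small e He) as [N' HN'].
  destruct (Ky e (max N N') He) as (n & Hn & D). destruct (Hphi n) as [P1 P2].
  exists (phi n); split; [lia|]. apply dist2_lt; simpl; split; trivial.
  apply Rlt_trans with (1 := P2). apply HN'; lia.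
Qed.

Definition cont_fun (h : pt -> R) : Prop :=
  forall p e, 0 < e -> exists d, 0 < d /\ forall q, dist2 p q < d -> Rabs (h p - h q) < e.

Lemma adherent_le (h : pt -> R) (u : nat -> pt) z r N :
  cont_fun h -> adherent u z -> (forall n, (N <= n)%nat -> h (u n) <= r) -> h z <= r.
Proof.
  intros Hh H Hr. destruct (Rle_or_lt (h z) r) as [|Hlt]; trivial.
  destruct (Hh z (h z - r)) as (d & Hd & K); [lra|].
  destruct (H d N Hd) as (n & Hn & D). specialize (K _ D); specialize (Hr n Hn).
  apply Rabs_def2 in K; lra.
Qed.

Lemma uniform_step (h : R -> R) e :
  continuity h -> 0 < e -> exists d, 0 < d /\
    forall s t, 0 <= s <= 1 -> 0 <= t <= 1 -> Rabs (s - t) < d -> Rabs (h s - h t) < e.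
Proof.
  intros H He.
  destruct (Heine h _ (compact_P3 0 1) (fun t _ => H t) (mkposreal e He)) as [d Hd].
  exists d; split; [apply cond_pos|]. intros s t Hs Ht Hst. exact (Hd s t Hs Ht Hst).
Qed.

Lemma path_uniform_step c e :
  path c -> 0 < e -> exists d, 0 < d /\
    forall s t, 0 <= s <= 1 -> 0 <= t <= 1 -> Rabs (s - t) < d -> dist2 (c s) (c t) < e.
Proof.
  intros [H1 H2] He.
  destruct (uniform_step _ e H1 He) as (d1 & P1 & K1).
  destruct (uniform_step _ e H2 He) as (d2 & P2 & K2).
  exists (Rmin d1 d2); split; [now apply Rmin_glb_lt|].
  intros s t Hs Ht Hst. apply dist2_lt.
  pose proof (Rmin_l d1 d2); pose proof (Rmin_r d1 d2).
  split; [apply K1|apply K2]; trivial; lra.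
Qed.

(* [c] starts left of the start of [d] and ends right of its end; the other
   conditions make the vector [c s - d t] turn once around [0] along the boundary
   of the parameter square. *)
Lemma paths_cross (c d : R -> pt) :
  path c -> path d ->
  fst (c 0) < fst (d 0) -> fst (d 1) < fst (c 1) ->
  (forall s, 0 <= s <= 1 -> fst (c s) <= fst (d 0) - 1 \/ snd (d 0) <= snd (c s)) ->
  (forall t, 0 <= t <= 1 -> fst (d t) <= fst (c 1) - 1 \/ snd (d t) <= snd (c 1)) ->
  (forall t, 0 <= t <= 1 -> fst (c 0) <= fst (d t) - 1 \/ snd (c 0) <= snd (d t)) ->
  (forall s, 0 <= s <= 1 -> snd (c s) <= snd (d 1)) ->
  exists s t, 0 <= s <= 1 /\ 0 <= t <= 1 /\ c s = d t.
Proof.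
  intros Hc Hd L0 L1 C1 C2 C3 C4.
  assert (A : forall e, 0 < e -> exists s t, 0 <= s <= 1 /\ 0 <= t <= 1 /\
     Rabs (fst (c s) - fst (d t)) <= e /\ Rabs (snd (c s) - snd (d t)) <= e).
  { assert (A : forall e, 0 < e -> e < fst (d 0) - fst (c 0) -> e < fst (c 1) - fst (d 1) ->
       e < 1 -> exists s t, 0 <= s <= 1 /\ 0 <= t <= 1 /\
       Rabs (fst (c s) - fst (d t)) <= e /\ Rabs (snd (c s) - snd (d t)) <= e).
    2:{ intros e He. set (r := Rmin (fst (d 0) - fst (c 0)) (fst (c 1) - fst (d 1))).
        assert (0 < r) by (apply Rmin_glb_lt; lra).
        (* Staying below both horizontal gaps gives the strict corner conditions of the grid lemma;
           staying below 1 excludes the alternatives with a margin of 1 in the boundary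
           hypotheses. *)
        set (e' := Rmin (Rmin e 1) r / 2).
        assert (0 < Rmin (Rmin e 1) r) by (repeat apply Rmin_glb_lt; lra).
        pose proof (Rmin_l (Rmin e 1) r). pose proof (Rmin_r (Rmin e 1) r).
        pose proof (Rmin_l e 1). pose proof (Rmin_r e 1).
        assert (r <= fst (d 0) - fst (c 0)) by apply Rmin_l.
        assert (r <= fst (c 1) - fst (d 1)) by apply Rmin_r.
        destruct (A e') as (s & t & h1 & h2 & h3 & h4); unfold e' in *; try lra.
        exists s, t. repeat split; try tauto; lra. }
    intros e He e0 e1 e2.
    destruct (path_uniform_step c (e / 2) Hc) as (r1 & P1 & K1); [lra|].
    destruct (path_uniform_step d (e / 2) Hd) as (r2 & P2 & K2); [lra|].
    (* The mesh [/ INR n] is finer than both moduli for [e / 2], so each coordinate of [c s - d t]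
       varies by at most [e] on a cell. *)
    destruct (archimed_cor1 (Rmin r1 r2)) as (n & N1 & N2); [now apply Rmin_glb_lt|].
    pose proof (Rmin_l r1 r2); pose proof (Rmin_r r1 r2).
    assert (Hn : 0 < INR n) by now apply lt_0_INR.
    assert (U : forall i, (i <= n)%nat -> 0 <= INR i / INR n <= 1).
    { intros i Hi. apply le_INR in Hi. pose proof (pos_INR i). split.
      - apply Rmult_le_pos; trivial. left; now apply Rinv_0_lt_compat.
      - apply Rmult_le_reg_r with (INR n); trivial. unfold Rdiv.
        rewrite Rmult_assoc, Rinv_l; lra. }
    assert (V : forall i i', (i <= i' <= S i)%nat ->
       Rabs (INR i / INR n - INR i' / INR n) < Rmin r1 r2).
    { intros i i' Hi. apply Rle_lt_trans with (2 := N1).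
      replace (INR i / INR n - INR i' / INR n) with ((INR i - INR i') * / INR n)
        by (field; lra).
      rewrite Rabs_mult, (Rabs_right (/ INR n))
        by (apply Rle_ge; left; now apply Rinv_0_lt_compat).
      rewrite <- (Rmult_1_l (/ INR n)) at 2.
      apply Rmult_le_compat_r; [left; now apply Rinv_0_lt_compat|].
      assert (i' = i \/ i' = S i) as [->| ->] by lia;
        [|rewrite S_INR]; apply Rabs_le; lra. }
    assert (Z0 : INR 0 / INR n = 0) by (simpl; field; lra).
    assert (Z1 : INR n / INR n = 1) by (field; lra).
    destruct (grid_small_value
      (fun i j => fst (c (INR i / INR n)) - fst (d (INR j / INR n)))
      (fun i j => snd (c (INR i / INR n)) - snd (d (INR j / INR n))) n e)
      as (i & j & Hi & Hj & B1 & B2); trivial; cbv beta; rewrite ?Z0, ?Z1; try lra.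
    - intros i j i' j' Hi Hj Hi' Hj'.
      assert (D1 : dist2 (c (INR i / INR n)) (c (INR i' / INR n)) < e / 2).
      { apply K1; try (apply U; lia). specialize (V i i' Hi); lra. }
      assert (D2 : dist2 (d (INR j / INR n)) (d (INR j' / INR n)) < e / 2).
      { apply K2; try (apply U; lia). specialize (V j j' Hj); lra. }
      apply dist2_lt in D1, D2. destruct D1 as [D1 D1'], D2 as [D2 D2'].
      apply Rabs_def2 in D1, D1', D2, D2'. split; apply Rabs_le; lra.
    - intros i Hi B. apply Rabs_le_bounds in B. destruct (C1 _ (U i Hi)); lra.
    - intros i Hi B. apply Rabs_le_bounds in B. destruct (C2 _ (U i Hi)); lra.
    - intros i Hi B. apply Rabs_le_bounds in B. destruct (C3 _ (U i Hi)); lra.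
    - intros i Hi B. pose proof (C4 _ (U i Hi)); lra.
    - exists (INR i / INR n), (INR j / INR n). auto. }
  destruct (choice _ _ (fun n (st : pt) => 0 <= fst st <= 1 /\ 0 <= snd st <= 1 /\
     Rabs (fst (c (fst st)) - fst (d (snd st))) <= / (INR n + 1) /\
     Rabs (snd (c (fst st)) - snd (d (snd st))) <= / (INR n + 1))) as [st Hst].
  { intros n. destruct (A (/ (INR n + 1))) as (s & t & H).
    - apply Rinv_0_lt_compat. pose proof (pos_INR n); lra.
    - exists (s, t); exact H. }
  destruct (rectangle_adherent st 0 1 0 1) as ([s t] & Hs & Ht & Had);
    try (intros n; apply Hst). simpl in Hs, Ht.
  exists s, t; repeat split; try lra.
  assert (B : forall e, 0 < e ->
     Rabs (fst (c s) - fst (d t)) <= e /\ Rabs (snd (c s) - snd (d t)) <= e).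
  { intros e He.
    destruct (path_near c s (e / 3) Hc) as (d1 & P1 & K1); [lra|].
    destruct (path_near d t (e / 3) Hd) as (d2 & P2 & K2); [lra|].
    destruct (inv_INR_small (e / 3)) as [N HN]; [lra|].
    destruct (Had (Rmin d1 d2) N) as (n & Hn & D); [now apply Rmin_glb_lt|].
    pose proof (Rmin_l d1 d2); pose proof (Rmin_r d1 d2).
    apply dist2_lt in D; simpl in D. destruct D as [D1 D2].
    specialize (K1 (fst (st n))); specialize (K2 (snd (st n))).
    rewrite Rabs_minus_sym in K1, K2.
    assert (Q1 := K1 ltac:(lra)). assert (Q2 := K2 ltac:(lra)).
    apply dist2_lt in Q1, Q2. destruct Q1 as [Q1 Q1'], Q2 as [Q2 Q2'].
    destruct (Hst n) as (_ & _ & B1 & B2). specialize (HN n Hn).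
    apply Rabs_def2 in Q1, Q1', Q2, Q2'. apply Rabs_le_bounds in B1, B2.
    split; apply Rabs_le; lra. }
  assert (Z : forall x y, (forall e, 0 < e -> Rabs (x - y) <= e) -> x = y).
  { intros x y H. apply cond_eq. intros e He.
    specialize (H (e / 2)). lra. }
  destruct (c s), (d t); simpl in B. f_equal; apply Z; intros; apply B; trivial.
Qed.

(** * Path-connectedness inside a set *)

Definition conn (P : pt -> Prop) (a b : pt) : Prop :=
  exists c, path c /\ c 0 = a /\ c 1 = b /\ forall t, 0 <= t <= 1 -> P (c t).

Lemma conn_weaken (P Q : pt -> Prop) a b :
  (forall z, P z -> Q z) -> conn P a b -> conn Q a b.
Proof. intros H (c & h1 & h2 & h3 & h4); exists c; auto 6. Qed.

Lemma conn_end P a b : conn P a b -> P b.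
Proof. intros (c & h1 & h2 & <- & h4). apply h4; lra. Qed.

Lemma conn_start P a b : conn P a b -> P a.
Proof. intros (c & h1 & <- & h3 & h4). apply h4; lra. Qed.

Lemma path_reparam c (h : R -> R) : path c -> continuity h -> path (fun t => c (h t)).
Proof.
  intros [H1 H2] Hh. split.
  - exact (continuity_comp h (fun t => fst (c t)) Hh H1).
  - exact (continuity_comp h (fun t => snd (c t)) Hh H2).
Qed.

Lemma conn_sym P a b : conn P a b -> conn P b a.
Proof.
  intros (c & h1 & h2 & h3 & h4). exists (fun t => c (1 - t)). repeat split.
  1,2: apply (path_reparam c (fun t => 1 - t)); trivial; reg.
  - now rewrite Rminus_0_r.
  - now rewrite Rminus_diag.
  - intros t Ht; apply h4; lra.
Qed.

Lemma conn_trans P a b c : conn P a b -> conn P b c -> conn P a c.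
Proof.
  intros (u & u1 & u2 & u3 & u4) (v & v1 & v2 & v3 & v4).
  (* [k] clamps the line onto the unit interval. The concatenation can then be written as a sum of
     two clamped paths minus the junction [b], which is continuous without any gluing argument. *)
  set (k := fun t => (Rabs t - Rabs (t - 1) + 1) / 2).
  assert (Hk : continuity k) by (unfold k; reg).
  assert (k0 : forall t, t <= 0 -> k t = 0).
  { intros t Ht; unfold k. rewrite !Rabs_left1 by lra. lra. }
  assert (k1 : forall t, 1 <= t -> k t = 1).
  { intros t Ht; unfold k. rewrite !Rabs_right by lra. lra. }
  assert (kt : forall t, 0 <= t <= 1 -> k t = t).
  { intros t Ht; unfold k. rewrite Rabs_right, Rabs_left1 by lra. lra. }
  assert (Pu : path (fun t => u (k (2 * t)))).
  { apply (path_reparam u (fun t => k (2 * t))); trivial.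
    apply (continuity_comp (fun t => 2 * t) k); trivial; reg. }
  assert (Pv : path (fun t => v (k (2 * t - 1)))).
  { apply (path_reparam v (fun t => k (2 * t - 1))); trivial.
    apply (continuity_comp (fun t => 2 * t - 1) k); trivial; reg. }
  exists (fun t => (fst (u (k (2 * t))) + fst (v (k (2 * t - 1))) - fst b,
                    snd (u (k (2 * t))) + snd (v (k (2 * t - 1))) - snd b)).
  assert (A : forall t, t <= 1/2 ->
    (fst (u (k (2 * t))) + fst (v (k (2 * t - 1))) - fst b,
     snd (u (k (2 * t))) + snd (v (k (2 * t - 1))) - snd b) = u (k (2 * t))).
  { intros t Ht. rewrite (k0 (2 * t - 1)), v2 by lra.
    rewrite (surjective_pairing (u (k (2 * t)))) at 3. f_equal; lra. }
  assert (B : forall t, 1/2 <= t ->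
    (fst (u (k (2 * t))) + fst (v (k (2 * t - 1))) - fst b,
     snd (u (k (2 * t))) + snd (v (k (2 * t - 1))) - snd b) = v (k (2 * t - 1))).
  { intros t Ht. rewrite (k1 (2 * t)), u3 by lra.
    rewrite (surjective_pairing (v (k (2 * t - 1)))) at 3. f_equal; lra. }
  repeat split.
  - simpl. apply continuity_minus; [apply continuity_plus|apply continuity_const; red; auto].
    + apply Pu.
    + apply Pv.
  - simpl. apply continuity_minus; [apply continuity_plus|apply continuity_const; red; auto].
    + apply Pu.
    + apply Pv.
  - rewrite A, k0 by lra; trivial.
  - rewrite B, k1 by lra; trivial.
  - intros t Ht. destruct (Rle_or_lt t (1/2)).
    + rewrite A, kt by lra. apply u4; lra.
    + rewrite B, kt by lra. apply v4; lra.
Qed.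

(** Each point of the path is reached by the initial piece [c (t * s)]. This allows a property of
    points reachable from [a] to be asserted all along the path. *)
Lemma conn_prefix P a b : conn P a b -> conn (fun z => conn P a z) a b.
Proof.
  intros (c & h1 & h2 & h3 & h4). exists c; repeat split; try apply h1; trivial.
  intros t Ht. exists (fun s => c (t * s)). repeat split.
  1,2: apply (path_reparam c (fun s => t * s)); trivial; reg.
  - now rewrite Rmult_0_r.
  - now rewrite Rmult_1_r.
  - intros s Hs. apply h4. nra.
Qed.

Lemma conn_map f (P Q : pt -> Prop) a b :
  cont2 f -> (forall z, P z -> Q (f z)) -> conn P a b -> conn Q (f a) (f b).
Proof.
  intros Hf H (c & h1 & <- & <- & h4). exists (fun t => f (c t)). repeat split; auto.
  all: now apply path_comp.
Qed.

Lemma conn_segment (P : pt -> Prop) a b :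
  (forall t, 0 <= t <= 1 -> P (fst a + t * (fst b - fst a), snd a + t * (snd b - snd a))) ->
  conn P a b.
Proof.
  intros H. exists (fun t => (fst a + t * (fst b - fst a), snd a + t * (snd b - snd a))).
  repeat split; trivial; simpl; try reg.
  - destruct a; simpl; f_equal; lra.
  - destruct a, b; simpl; f_equal; lra.
Qed.

Lemma conn_level f (P : pt -> Prop) a b r :
  cont2 f -> conn P a b -> (snd (f a) - r) * (snd (f b) - r) <= 0 ->
  exists z, P z /\ snd (f z) = r.
Proof.
  intros Hf (c & h1 & h2 & h3 & h4) H.
  destruct (IVT_cor (fun t => snd (f (c t)) - r) 0 1) as (t & Ht & E); try lra.
  - apply continuity_minus; [apply (path_comp f c Hf h1)|apply continuity_const; red; auto].
  - now rewrite h2, h3.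
  - exists (c t); split; [now apply h4|lra].
Qed.

(** The intermediate value theorem is applied to every initial piece of the path, through
    [conn_prefix]. *)
Lemma conn_above f (P : pt -> Prop) a b r :
  cont2 f -> (forall z, P z -> snd (f z) <> r) -> r < snd (f a) ->
  conn P a b -> conn (fun z => P z /\ r < snd (f z)) a b.
Proof.
  intros Hf Hr Ha C. apply conn_prefix in C. revert C; apply conn_weaken.
  intros z Cz. split; [now apply conn_end in Cz|].
  destruct (Rlt_or_le r (snd (f z))) as [|Hle]; trivial.
  destruct (conn_level f P a z r Hf Cz) as (w & Pw & E); [nra|].
  now elim (Hr w Pw).
Qed.

Lemma conn_below f (P : pt -> Prop) a b r :
  cont2 f -> (forall z, P z -> snd (f z) <> r) -> snd (f a) < r ->
  conn P a b -> conn (fun z => P z /\ snd (f z) < r) a b.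
Proof.
  intros Hf Hr Ha C. apply conn_prefix in C. revert C; apply conn_weaken.
  intros z Cz. split; [now apply conn_end in Cz|].
  destruct (Rlt_or_le (snd (f z)) r) as [|Hle]; trivial.
  destruct (conn_level f P a z r Hf Cz) as (w & Pw & E); [nra|].
  now elim (Hr w Pw).
Qed.

(** The witness is the supremum of the times up to which [h] has stayed at most [r]; the value [r]
    may have been attained earlier. *)
Lemma first_hit (h : R -> R) r :
  continuity h -> h 0 <= r -> r <= h 1 ->
  exists t, 0 <= t <= 1 /\ h t = r /\ forall s, 0 <= s <= t -> h s <= r.
Proof.
  intros Hh H0 H1.
  destruct (completeness (fun t => 0 <= t <= 1 /\ forall s, 0 <= s <= t -> h s <= r))
    as [t [Hub Hl]].
  - exists 1; intros t [Ht _]; lra.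
  - exists 0; split; [lra|]. intros s Hs; replace s with 0 by lra; trivial.
  - assert (T0 : 0 <= t).
    { apply Hub. split; [lra|]. intros s Hs; replace s with 0 by lra; trivial. }
    assert (T1 : t <= 1) by (apply Hl; intros x [Hx _]; lra).
    assert (L : forall s, 0 <= s < t -> h s <= r).
    { intros s Hs. apply NNPP; intros N.
      assert (t <= s); [|lra]. apply Hl. intros x [Hx Kx].
      destruct (Rle_or_lt x s); trivial. elim N; apply Kx; lra. }
    assert (E1 : h t <= r).
    { destruct (Rle_or_lt (h t) r) as [|Hlt]; trivial.
      destruct (continuity_elim h t (h t - r) Hh) as (d & Hd & K); [lra|].
      destruct (Req_dec t 0) as [->|Hn]; [lra|].
      set (s := Rmax 0 (t - d / 2)).
      assert (0 <= s < t) by (unfold s, Rmax; destruct Rle_dec; lra).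
      assert (B : Rabs (s - t) < d).
      { apply Rabs_def1; unfold s, Rmax; destruct Rle_dec; lra. }
      apply K in B. apply Rabs_def2 in B. specialize (L s H). lra. }
    assert (L' : forall s, 0 <= s <= t -> h s <= r).
    { intros s Hs. destruct (Req_dec s t) as [->|]; trivial. apply L; lra. }
    exists t; repeat split; trivial.
    destruct (Rle_or_lt r (h t)) as [|Hlt]; [lra|].
    destruct (continuity_elim h t (r - h t) Hh) as (d & Hd & K); [lra|].
    destruct (Req_dec t 1) as [->|Hn]; [lra|].
    set (s := Rmin 1 (t + d / 2)).
    assert (Hs : t < s <= 1 /\ s <= t + d / 2) by (unfold s, Rmin; destruct Rle_dec; lra).
    assert (s <= t); [|lra]. apply Hub. split; [lra|].
    intros x Hx. destruct (Rle_or_lt x t); [apply L'; lra|].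
    assert (B : Rabs (x - t) < d) by (apply Rabs_def1; lra).
    apply K in B. apply Rabs_def2 in B. lra.
Qed.

(** The factor [sg] is meant to be 1 or -1, for a path cut at its exit through an upper or through a
    lower level. *)
Lemma conn_first_hit f (P : pt -> Prop) a b (sg r : R) :
  cont2 f -> conn P a b -> sg * snd (f a) <= r -> r <= sg * snd (f b) ->
  exists b', sg * snd (f b') = r /\ conn (fun z => P z /\ sg * snd (f z) <= r) a b'.
Proof.
  intros Hf (c & h1 & h2 & h3 & h4) Ha Hb.
  destruct (first_hit (fun t => sg * snd (f (c t))) r) as (t & Ht & E & K).
  - apply (continuity_scal (fun t => snd (f (c t)))), (path_comp f c Hf h1).
  - now rewrite h2.
  - now rewrite h3.
  - exists (c t); split; trivial. exists (fun s => c (t * s)). repeat split.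
    1,2: apply (path_reparam c (fun s => t * s)); trivial; reg.
    + now rewrite Rmult_0_r.
    + now rewrite Rmult_1_r.
    + apply h4; nra.
    + apply K; nra.
Qed.

Lemma continuity_bounded (h : R -> R) :
  continuity h -> exists B, forall t, 0 <= t <= 1 -> Rabs (h t) <= B.
Proof.
  intros Hh.
  destruct (continuity_ab_maj h 0 1) as (M & HM & _); [lra|intros; apply Hh|].
  destruct (continuity_ab_min h 0 1) as (m & Hm & _); [lra|intros; apply Hh|].
  exists (Rabs (h M) + Rabs (h m)). intros t Ht.
  specialize (HM t Ht); specialize (Hm t Ht).
  pose proof (Rle_abs (h M)). pose proof (Rle_abs (- h m)).
  pose proof (Rabs_pos (h M)). pose proof (Rabs_pos (h m)).
  rewrite Rabs_Ropp in *. apply Rabs_le; lra.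
Qed.

Lemma conn_bounded P a b :
  conn P a b -> exists B, 0 <= B /\ conn (fun z => P z /\ Rabs (fst z) <= B) a b.
Proof.
  intros (c & h1 & h2 & h3 & h4).
  destruct (continuity_bounded _ (proj1 h1)) as [B HB].
  exists B; split.
  - pose proof (HB 0 ltac:(lra)). pose proof (Rabs_pos (fst (c 0))). lra.
  - exists c; repeat split; auto; apply h1.
Qed.

Lemma conn_cross (P Q : pt -> Prop) x0 x1 y0 y1 :
  conn P x0 x1 -> conn Q y0 y1 ->
  fst x0 < fst y0 -> fst y1 < fst x1 ->
  (forall x, P x -> fst x <= fst y0 - 1 \/ snd y0 <= snd x) ->
  (forall y, Q y -> fst y <= fst x1 - 1 \/ snd y <= snd x1) ->
  (forall y, Q y -> fst x0 <= fst y - 1 \/ snd x0 <= snd y) ->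
  (forall x, P x -> snd x <= snd y1) ->
  exists z, P z /\ Q z.
Proof.
  intros (c & c1 & <- & <- & Hc) (d & d1 & <- & <- & Hd) H1 H2 C1 C2 C3 C4.
  destruct (paths_cross c d) as (s & t & Hs & Ht & E); auto.
  exists (c s); split; [|rewrite E]; auto.
Qed.

(** * Orbits and drift *)

Lemma iter_add m n f z : iter (m + n) f z = iter m f (iter n f z).
Proof. induction m as [|m IH]; simpl; congruence. Qed.

Lemma iter_cancel f g n z :
  (forall p, g (f p) = p) -> iter n g (iter n f z) = z.
Proof.
  intros H. induction n as [|n IH]; trivial.
  rewrite <- Nat.add_1_r at 1. rewrite iter_add. simpl. now rewrite H.
Qed.

Lemma iter_cancel_le f g k n z :
  (forall p, g (f p) = p) -> (k <= n)%nat -> iter k g (iter n f z) = iter (n - k) f z.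
Proof.
  intros H Hk. replace n with (k + (n - k))%nat at 1 by lia.
  rewrite iter_add. now apply iter_cancel.
Qed.

Lemma cont2_iter f n : cont2 f -> cont2 (iter n f).
Proof.
  intros Hf. induction n as [|n IH]; intros p e He; simpl.
  - exists e; auto.
  - destruct (Hf (iter n f p) e He) as (d & Hd & K).
    destruct (IH p d Hd) as (d' & Hd' & K'). exists d'; auto.
Qed.

Definition shift (k : Z) (z : pt) : pt := (fst z + IZR k, snd z).

Lemma shift_nat f k z :
  commutes_with_T f -> f (shift (Z.of_nat k) z) = shift (Z.of_nat k) (f z).
Proof.
  intros Hf. induction k as [|k IH].
  - unfold shift; simpl. rewrite !Rplus_0_r, <- !surjective_pairing. reflexivity.
  - rewrite Nat2Z.inj_succ.
    assert (S : forall w, shift (Z.succ (Z.of_nat k)) w = Ttr (shift (Z.of_nat k) w)).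
    { intros w. unfold shift, Ttr; simpl. rewrite succ_IZR. f_equal; lra. }
    now rewrite !S, Hf, IH.
Qed.

Lemma shift_shift k l z : shift k (shift l z) = shift (k + l) z.
Proof. unfold shift; simpl. rewrite plus_IZR. f_equal; lra. Qed.

Lemma shift_0 z : shift 0 z = z.
Proof. unfold shift. rewrite Rplus_0_r. now destruct z. Qed.

Lemma shift_comm f k z : commutes_with_T f -> f (shift k z) = shift k (f z).
Proof.
  intros Hf. destruct (Z.le_gt_cases 0 k).
  - rewrite <- (Z2Nat.id k) by trivial. now apply shift_nat.
  - pose proof (shift_nat f (Z.to_nat (- k)) (shift k z) Hf) as E.
    rewrite Z2Nat.id in E by lia.
    rewrite shift_shift, Z.add_opp_diag_l, shift_0 in E.
    rewrite E, shift_shift, Z.add_opp_diag_r, shift_0. reflexivity.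
Qed.

Lemma shift_iter f k n z : commutes_with_T f -> iter n f (shift k z) = shift k (iter n f z).
Proof.
  intros Hf. induction n as [|n IH]; trivial. simpl. rewrite IH. now apply shift_comm.
Qed.

Lemma shift_into_unit z : exists k, 0 <= fst (shift k z) <= 1.
Proof.
  exists (- Int_part (fst z))%Z. unfold shift; simpl. rewrite opp_IZR.
  destruct (base_Int_part (fst z)); lra.
Qed.

Lemma inverse_commutes f g :
  (forall p, g (f p) = p) -> (forall p, f (g p) = p) ->
  commutes_with_T f -> commutes_with_T g.
Proof.
  intros gf fg Hf p. rewrite <- (fg p) at 1. now rewrite <- Hf, gf.
Qed.

Lemma cont2_shift k : cont2 (shift k).
Proof.
  intros p e He; exists e; split; trivial. intros q Hq. apply dist2_lt in Hq.
  apply dist2_lt; unfold shift; simpl.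
  replace (fst p + IZR k - (fst q + IZR k)) with (fst p - fst q) by lra. trivial.
Qed.

(** Horizontal displacement and height of the image are invariant under [T], so points violating
    larger and larger bounds can be moved to abscissas between 0 and 1. They then accumulate, and
    continuity at a cluster point gives a contradiction. *)
Lemma band_bound f a b :
  cont2 f -> commutes_with_T f ->
  exists B, forall z, a <= snd z <= b ->
    Rabs (fst (f z) - fst z) <= B /\ Rabs (snd (f z)) <= B.
Proof.
  intros Hf HT. apply NNPP; intros C.
  destruct (choice _ _ (fun (n : nat) z => 0 <= fst z <= 1 /\ a <= snd z <= b /\
     (INR n < Rabs (fst (f z) - fst z) \/ INR n < Rabs (snd (f z))))) as [u Hu].
  { intros n. apply NNPP; intros D. apply C. exists (INR n). intros z Hz.
    destruct (shift_into_unit z) as [k Hk].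
    assert (A : Rabs (fst (f (shift k z)) - fst (shift k z)) <= INR n /\
                Rabs (snd (f (shift k z))) <= INR n).
    { split; apply Rnot_lt_le; intros N; apply D; exists (shift k z); auto. }
    rewrite shift_comm in A by trivial. unfold shift in A; simpl in A.
    now replace (fst (f z) + IZR k - (fst z + IZR k)) with (fst (f z) - fst z) in A by lra. }
  destruct (rectangle_adherent u 0 1 a b) as (z & Hz1 & Hz2 & Had); try (intros; apply Hu).
  destruct (Hf z 1 Rlt_0_1) as (d & Hd & K).
  destruct (INR_unbounded (Rabs (fst (f z)) + Rabs (snd (f z)) + 3)) as [N HN].
  destruct (Had d N Hd) as (n & Hn & D). apply K, dist2_lt in D. destruct D as [D1 D2].
  apply le_INR in Hn. destruct (Hu n) as (U1 & _ & U3).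
  pose proof (Rle_abs (fst (f z))). pose proof (Rle_abs (- fst (f z))).
  pose proof (Rle_abs (snd (f z))). pose proof (Rle_abs (- snd (f z))).
  rewrite Rabs_Ropp in *. apply Rabs_def2 in D1, D2.
  assert (Rabs (fst (f (u n)) - fst (u n)) <= INR n) by (apply Rabs_le; lra).
  assert (Rabs (snd (f (u n))) <= INR n) by (apply Rabs_le; lra). lra.
Qed.

(** * Rotation numbers and uniform drift *)

Lemma iter_displacement f (P : pt -> Prop) B :
  (forall z, P z -> Rabs (fst (f z) - fst z) <= B) ->
  forall z, (forall n, P (iter n f z)) -> forall n,
  Rabs (fst (iter n f z) - fst z) <= B * INR n.
Proof.
  intros HB z Hz n. induction n as [|n IH].
  - simpl. rewrite Rmult_0_r. unfold Rminus; rewrite Rplus_opp_r, Rabs_R0; lra.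
  - rewrite S_INR. pose proof (HB _ (Hz n)) as D. simpl.
    apply Rabs_le_bounds in D, IH. apply Rabs_le; lra.
Qed.

(** Otherwise there are mean displacements [v m], over times tending to infinity, with [sg * v m]
    below [/ (INR m + 1)]. They are bounded by [B], so they accumulate at a finite rotation number
    [l], and [sg * l] cannot be positive. *)
Lemma uniform_drift f (E : pt -> Prop) B sg :
  (sg = 1 \/ sg = -1) ->
  (forall z, E z -> forall n, E (iter n f z)) ->
  (forall z, E z -> Rabs (fst (f z) - fst z) <= B) ->
  (forall x, rho_in f E x -> exists r, x = Fin r /\ 0 < sg * r) ->
  exists d m, 0 < d /\ forall n z, (m <= n)%nat -> E z ->
    d * INR n <= sg * (fst (iter n f z) - fst z).
Proof.
  intros Hsg Hinv HB Hrho. apply NNPP; intros C.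
  destruct (choice _ _ (fun (m : nat) (nz : nat * pt) => (S m <= fst nz)%nat /\ E (snd nz) /\
     sg * (fst (iter (fst nz) f (snd nz)) - fst (snd nz)) < / (INR m + 1) * INR (fst nz)))
    as [w Hw].
  { intros m. apply NNPP; intros D. apply C. exists (/ (INR m + 1)), (S m). split.
    - apply Rinv_0_lt_compat; pose proof (pos_INR m); lra.
    - intros n z Hn Hz. apply Rnot_lt_le; intros L. apply D. exists (n, z); auto. }
  set (v := fun m => (fst (iter (fst (w m)) f (snd (w m))) - fst (snd (w m))) / INR (fst (w m))).
  assert (Hv : forall m, sg * v m < / (INR m + 1) /\ - B <= v m <= B).
  { intros m. destruct (Hw m) as (h1 & h2 & h3).
    assert (P : 0 < INR (fst (w m))) by (apply lt_0_INR; lia).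
    pose proof (iter_displacement f E B HB _ (Hinv _ h2) (fst (w m))) as D.
    apply Rabs_le_bounds in D.
    assert (Ev : v m * INR (fst (w m)) = fst (iter (fst (w m)) f (snd (w m))) - fst (snd (w m)))
      by (unfold v; field; lra).
    rewrite <- Ev in D, h3.
    repeat split; apply Rnot_lt_le || apply Rnot_le_lt; intros N; nra. }
  destruct (adherent_subsequence v (- B) B) as (l & _ & Hl); [intros; apply Hv|].
  destruct (Hrho (Fin l)) as (r & Er & Hr).
  { intros m Hm e He. destruct (Hl e m He) as (n & Hn & D).
    exists (v n); split; [|now rewrite Rabs_minus_sym].
    destruct (Hw n) as (h1 & h2 & _).
    exists (fst (w n)), (snd (w n)). repeat split; auto; lia. }
  injection Er as <-.
  destruct (inv_INR_small (sg * l / 2)) as [N HN]; [lra|].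
  destruct (Hl (sg * l / 2) N) as (n & Hn & D); [lra|].
  specialize (HN n Hn). destruct (Hv n) as [h _]. apply Rabs_def2 in D.
  destruct Hsg as [-> | ->]; lra.
Qed.

Lemma adherent_band h u z a b N :
  cont2 h -> adherent u z -> (forall n, (N <= n)%nat -> a <= snd (h (u n)) <= b) ->
  a <= snd (h z) <= b.
Proof.
  intros Hh Hz H.
  split; apply Rnot_lt_le; intros L.
  - destruct (Hh z (a - snd (h z))) as (d & Hd & K); [lra|].
    destruct (Hz d N Hd) as (n & Hn & D). apply K, dist2_lt in D. destruct D as [_ D].
    apply Rabs_def2 in D. specialize (H n Hn); lra.
  - destruct (Hh z (snd (h z) - b)) as (d & Hd & K); [lra|].
    destruct (Hz d N Hd) as (n & Hn & D). apply K, dist2_lt in D. destruct D as [_ D].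
    apply Rabs_def2 in D. specialize (H n Hn); lra.
Qed.

Lemma cont_fun_displacement f sg :
  cont2 f -> Rabs sg <= 1 -> cont_fun (fun z => sg * (fst (f z) - fst z)).
Proof.
  intros Hf Hs p e He. destruct (Hf p (e / 2)) as (d & Hd & K); [lra|].
  exists (Rmin d (e / 2)); split; [apply Rmin_glb_lt; lra|].
  intros q Hq. pose proof (Rmin_l d (e / 2)). pose proof (Rmin_r d (e / 2)).
  assert (Hq' : dist2 p q < d) by lra. apply K, dist2_lt in Hq'. apply dist2_lt in Hq.
  replace (sg * (fst (f p) - fst p) - sg * (fst (f q) - fst q))
    with (sg * ((fst (f p) - fst (f q)) - (fst p - fst q))) by ring.
  rewrite Rabs_mult.
  assert (D : Rabs ((fst (f p) - fst (f q)) - (fst p - fst q)) < e).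
  { destruct Hq as [Hq _], Hq' as [Hq' _]. apply Rabs_def2 in Hq, Hq'. apply Rabs_def1; lra. }
  pose proof (Rabs_pos (fst (f p) - fst (f q) - (fst p - fst q))).
  pose proof (Rabs_pos sg). nra.
Qed.

Section Homeo.
Variables f g : pt -> pt.
Hypotheses (Hf : cont2 f) (Hg : cont2 g).
Hypotheses (gf : forall p, g (f p) = p) (fg : forall p, f (g p) = p).
Hypothesis HT : commutes_with_T f.

Lemma Theta_intro (E : pt -> Prop) z :
  (forall n, E (iter n f z)) -> (forall n, E (iter n g z)) -> Theta f E z.
Proof.
  intros H1 H2. split; [exact (H1 O)|split; trivial].
  intros n y Hy. rewrite <- (iter_cancel f g n y gf), Hy. apply H2.
Qed.

Lemma Theta_iter (E : pt -> Prop) z n : Theta f E z -> Theta f E (iter n f z).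
Proof.
  intros (H0 & H1 & H2). apply Theta_intro; intros k.
  - rewrite <- iter_add; apply H1.
  - destruct (Nat.le_gt_cases k n) as [L|L].
    + rewrite iter_cancel_le by trivial. apply H1.
    + replace k with ((k - n) + n)%nat by lia.
      rewrite iter_add, iter_cancel by trivial.
      apply (H2 (k - n)%nat). now apply iter_cancel.
Qed.

(* Limit points, modulo translation, of a sequence whose orbits eventually stay in
   the band belong to [Theta]; so the drift of [Theta] is inherited by the sequence. *)
Lemma drift_near_Theta a b n0 sg (u : nat -> pt) :
  (sg = 1 \/ sg = -1) ->
  (forall k, a <= snd (u k) <= b) ->
  (forall j k, (j <= k)%nat -> a <= snd (iter j f (u k)) <= b) ->
  (forall j k, (j <= k)%nat -> a <= snd (iter j g (u k)) <= b) ->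
  (forall z, Theta f (band a b) z -> 2 <= sg * (fst (iter n0 f z) - fst z)) ->
  exists K, forall k, (K <= k)%nat -> 1 <= sg * (fst (iter n0 f (u k)) - fst (u k)).
Proof.
  intros Hsg Hu Hfu Hgu HTh. apply NNPP; intros C.
  assert (Hs : Rabs sg <= 1) by (destruct Hsg as [-> | ->]; apply Rabs_le; lra).
  assert (HTg := inverse_commutes f g gf fg HT).
  destruct (choice _ _ (fun (K : nat) v => exists k l, (K <= k)%nat /\ v = shift l (u k) /\
     0 <= fst v <= 1 /\ sg * (fst (iter n0 f v) - fst v) <= 1)) as [v Hv].
  { intros K. apply NNPP; intros D. apply C. exists K. intros k Hk.
    apply Rnot_lt_le; intros L. apply D.
    destruct (shift_into_unit (u k)) as [l Hl].
    exists (shift l (u k)), k, l. repeat split; trivial; try apply Hl.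
    rewrite shift_iter by trivial. unfold shift; simpl.
    replace (fst (iter n0 f (u k)) + IZR l - (fst (u k) + IZR l))
      with (fst (iter n0 f (u k)) - fst (u k)) by ring. lra. }
  destruct (rectangle_adherent v 0 1 a b) as (z & _ & _ & Hz).
  { intros n; destruct (Hv n) as (k & l & _ & _ & h & _); exact h. }
  { intros n; destruct (Hv n) as (k & l & _ & -> & _). apply Hu. }
  (* For a fixed time [j] the constraint holds for all indices at least [j], hence at the cluster
     point. *)
  assert (HTz : Theta f (band a b) z).
  { apply Theta_intro; intros j; apply (adherent_band _ v z a b j); trivial;
      try (now apply cont2_iter);
      intros n Hn; destruct (Hv n) as (k & l & Hk & -> & _);
      rewrite shift_iter by trivial; [apply Hfu|apply Hgu]; lia. }
  assert (D := adherent_le _ _ _ 1 0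
    (cont_fun_displacement (iter n0 f) sg (cont2_iter f n0 Hf) Hs) Hz).
  cbv beta in D. specialize (HTh z HTz).
  assert (sg * (fst (iter n0 f z) - fst z) <= 1); [|lra].
  apply D. intros n _. destruct (Hv n) as (k & l & _ & _ & _ & h). exact h.
Qed.

Lemma drift_sum (u : nat -> R) n0 K :
  (forall k, (K <= k)%nat -> u (n0 + k)%nat <= u k - 1) ->
  forall j, u (j * n0 + K)%nat <= u K - INR j.
Proof.
  intros H j. induction j as [|j IH].
  - simpl; lra.
  - rewrite S_INR. replace (S j * n0 + K)%nat with (n0 + (j * n0 + K))%nat by lia.
    specialize (H (j * n0 + K)%nat). assert (K <= j * n0 + K)%nat by lia.
    specialize (H H0); lra.
Qed.

(* Along the orbit of [z] the abscissa increases linearly in the past and decreases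
   linearly in the future, so arbitrarily long orbit segments have bounded
   horizontal displacement. *)
Lemma connecting_orbit_zero c0 c1 c2 z :
  c1 <= c0 -> c2 <= c1 ->
  (forall k, c1 <= snd (iter k g z) <= c0) ->
  (forall k, c2 <= snd (iter (S k) f z) <= c1) ->
  (forall x, rho_in f (Theta f (band c1 c0)) x -> exists r, x = Fin r /\ 0 < r) ->
  (forall x, rho_in f (Theta f (band c2 c1)) x -> exists r, x = Fin r /\ r < 0) ->
  rho_in f (Theta f (fun p => band c1 c0 p \/ band c2 c1 p)) (Fin 0).
Proof.
  intros L1 L2 Hpast Hfut R0 R1.
  destruct (band_bound f c2 c0 Hf HT) as [B HB].
  assert (HTg := inverse_commutes f g gf fg HT).
  destruct (uniform_drift f (Theta f (band c1 c0)) B 1) as (d & m & Hd & D); auto.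
  { intros w Hw n. now apply Theta_iter. }
  { intros w [Hw _]. apply HB. unfold band in Hw; lra. }
  { intros x Hx. destruct (R0 x Hx) as (r & -> & Hr). exists r; split; trivial; lra. }
  destruct (uniform_drift f (Theta f (band c2 c1)) B (-1)) as (d' & m' & Hd' & D'); auto.
  { intros w Hw n. now apply Theta_iter. }
  { intros w [Hw _]. apply HB. unfold band in Hw; lra. }
  { intros x Hx. destruct (R1 x Hx) as (r & -> & Hr). exists r; split; trivial; lra. }
  (* Block lengths over which points of [Theta] drift by at least 2; [drift_near_Theta] then leaves
     a drift of 1 per block on the orbit of [z]. *)
  assert (Long : forall d m, 0 < d -> exists n, (1 <= n)%nat /\ (m <= n)%nat /\ 2 <= d * INR n).
  { clear. intros d m Hd. destruct (INR_unbounded (2 / d)) as [n Hn].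
    exists (S (max m n)). split; [lia|split; [lia|]].
    assert (INR n <= INR (S (max m n))) by (apply le_INR; lia).
    apply Rmult_le_reg_l with (/ d); [now apply Rinv_0_lt_compat|].
    rewrite <- Rmult_assoc, Rinv_l, Rmult_1_l by lra. unfold Rdiv in Hn; lra. }
  destruct (Long d m Hd) as (n0 & N1 & N2 & N3).
  destruct (Long d' m' Hd') as (n1 & M1 & M2 & M3).
  destruct (drift_near_Theta c1 c0 n0 1 (fun k => iter k g z)) as [K HK]; auto.
  { intros j k Hjk. rewrite iter_cancel_le by trivial. apply Hpast. }
  { intros j k Hjk. rewrite <- iter_add. apply Hpast. }
  { intros w Hw. specialize (D n0 w N2 Hw). lra. }
  destruct (drift_near_Theta c2 c1 n1 (-1) (fun k => iter (S k) f z)) as [K' HK']; auto.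
  { intros j k Hjk. rewrite <- iter_add.
    replace (j + S k)%nat with (S (j + k)) by lia. apply Hfut. }
  { intros j k Hjk. rewrite iter_cancel_le by (trivial; lia).
    replace (S k - j)%nat with (S (k - j)) by lia. apply Hfut. }
  { intros w Hw. specialize (D' n1 w M2 Hw). lra. }
  cbv beta in HK, HK'.
  assert (A := drift_sum (fun k => fst (iter k g z)) n0 K).
  assert (A' := drift_sum (fun k => fst (iter (S k) f z)) n1 K').
  cbv beta in A, A'.
  assert (AA : forall j, fst (iter (j * n0 + K) g z) <= fst (iter K g z) - INR j).
  { apply A. intros k Hk. assert (Hk' : (K <= n0 + k)%nat) by lia. specialize (HK _ Hk').
    rewrite iter_cancel_le in HK by (trivial; lia).
    replace (n0 + k - n0)%nat with k in HK by lia. lra. }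
  assert (AA' : forall j, fst (iter (S (j * n1 + K')) f z) <= fst (iter (S K') f z) - INR j).
  { apply A'. intros k Hk. specialize (HK' _ Hk). rewrite <- iter_add in HK'.
    replace (S (n1 + k)) with (n1 + S k)%nat by lia. lra. }
  clear A A'.
  assert (InA : forall l n, let P := fun p => band c1 c0 p \/ band c2 c1 p in
                P (iter n f (iter l g z))).
  { intros l n P. destruct (Nat.le_gt_cases n l).
    - rewrite iter_cancel_le by trivial. left; apply Hpast.
    - right. replace n with (S (n - S l) + l)%nat by lia.
      rewrite iter_add, iter_cancel by trivial. apply Hfut. }
  assert (Th : forall l, Theta f (fun p => band c1 c0 p \/ band c2 c1 p) (iter l g z)).
  { intros l. apply Theta_intro; intros n; [apply (InA l n)|].
    rewrite <- iter_add. left; apply Hpast. }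
  intros q Hq e He.
  (* The three variable terms make [y] lie to the left of [z], make [B / INR l] smaller than [e],
     and make [l] at least [q]. *)
  destruct (INR_unbounded (Rabs (fst (iter K g z) - fst z) + B / e + INR q + 1)) as [j Hj].
  set (l := (j * n0 + K)%nat).
  assert (BP : 0 <= B).
  { destruct (HB z) as [h _]; [specialize (Hpast 0%nat); simpl in Hpast; lra|].
    pose proof (Rabs_pos (fst (f z) - fst z)); lra. }
  assert (BE : 0 <= B / e) by (apply Rmult_le_pos; trivial; left; now apply Rinv_0_lt_compat).
  assert (jl : INR j <= INR l) by (apply le_INR; unfold l; nia).
  pose proof (Rabs_pos (fst (iter K g z) - fst z)) as Pa.
  pose proof (pos_INR q) as Pq.
  assert (ql : (q <= l)%nat) by (apply INR_le; lra).
  set (y := iter l g z).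
  assert (Hy : fst y < fst z).
  { specialize (AA j). fold l y in AA. pose proof (Rle_abs (fst (iter K g z) - fst z)). lra. }
  assert (Hend : exists n, (l <= n)%nat /\ fst (iter n f y) <= fst y).
  { destruct (INR_unbounded (fst (iter (S K') f z) - fst y)) as [i Hi].
    exists (S (i * n1 + K') + l)%nat; split; [lia|].
    unfold y at 1. rewrite iter_add, iter_cancel by trivial.
    specialize (AA' i). lra. }
  assert (Hl : fst y < fst (iter l f y)) by (unfold y at 2; now rewrite iter_cancel).
  assert (Hstep : forall n, Rabs (fst (iter (S n) f y) - fst (iter n f y)) <= B).
  { intros n. apply HB. destruct (InA l n) as [h|h]; unfold band in h; fold y in h; lra. }
  (* A discrete intermediate value argument: at time [l] the orbit of [y] is at [z], to the right of
     [y]; the step that brings it back to the left has length at most [B], so it lands within [B] of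
     the abscissa of [y]. *)
  assert (Hn : exists n, (l <= n)%nat /\ Rabs (fst (iter n f y) - fst y) <= B).
  { destruct Hend as (n & Hln & Hn). revert Hn. induction Hln as [|n Hln IH]; intros Hn; [lra|].
    destruct (Rle_or_lt (fst (iter n f y)) (fst y)); [auto|].
    exists (S n); split; [lia|]. specialize (Hstep n). apply Rabs_le_bounds in Hstep.
    apply Rabs_le; lra. }
  destruct Hn as (n & Hln & Hn).
  exists ((fst (iter n f y) - fst y) / INR n). split.
  - exists n, y. split; [lia|split; [apply Th|split; [apply Theta_iter, Th|reflexivity]]].
  - assert (Hnl : INR l <= INR n) by now apply le_INR.
    assert (P : 0 < INR n) by lra.
    rewrite Rminus_0_r. unfold Rdiv. rewrite Rabs_mult, (Rabs_right (/ INR n))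
      by (apply Rle_ge; left; now apply Rinv_0_lt_compat).
    apply Rle_lt_trans with (B * / INR n).
    + apply Rmult_le_compat_r; trivial. left; now apply Rinv_0_lt_compat.
    + apply Rmult_lt_reg_r with (INR n); trivial.
      rewrite Rmult_assoc, Rinv_l, Rmult_1_r by lra.
      assert (B = B / e * e) by (field; lra). nra.
Qed.
End Homeo.

(** * Absence of long transits *)

Section Descent.
Variable f : pt -> pt.

(** The half-plane form of the condition on a line, which can be iterated along orbits. *)
Definition descends (r : R) : Prop := forall z, snd z <= r -> snd (f z) < r.

Lemma descends_lt r m n z :
  descends r -> (m < n)%nat -> snd (iter m f z) <= r -> snd (iter n f z) < r.
Proof.
  intros Hr Hmn Hm. induction Hmn as [|n Hmn IH]; simpl; apply Hr; lra.
Qed.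

Lemma descends_le r m n z :
  descends r -> (m <= n)%nat -> snd (iter m f z) <= r -> snd (iter n f z) <= r.
Proof.
  intros Hr Hmn Hm. destruct (Nat.eq_dec m n) as [<-|]; trivial.
  left; apply (descends_lt r m); trivial; lia.
Qed.

Lemma crossing_time r a b z :
  (a <= b)%nat -> r <= snd (iter a f z) -> snd (iter b f z) < r ->
  exists k, (a <= k < b)%nat /\ r <= snd (iter k f z) /\ snd (iter (S k) f z) <= r.
Proof.
  intros Hab Ha. induction Hab as [|b Hab IH]; intros Hb; [lra|].
  destruct (Rlt_or_le (snd (iter b f z)) r) as [L|L].
  - destruct (IH L) as (k & h1 & h2 & h3). exists k; repeat split; trivial; lia.
  - exists b; repeat split; trivial; lia || lra.
Qed.
End Descent.

Section NoTransit.
Variables f g : pt -> pt.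
Hypotheses (Hf : cont2 f) (Hg : cont2 g).
Hypotheses (gf : forall p, g (f p) = p) (fg : forall p, f (g p) = p).
Hypothesis HT : commutes_with_T f.
Variables c0 c1 c2 : R.
Hypotheses (c10 : c1 < c0) (c21 : c2 < c1).
Hypotheses (desc0 : descends f c0) (desc1 : descends f c1) (desc2 : descends f c2).
Variable N : nat.
Hypothesis N_pos : (1 <= N)%nat.
(** The negation, for one value of [N], of the supply of transits from which [connecting_orbit]
    builds its orbit. *)
Hypothesis no_transit : forall y, snd y <= c0 -> c2 <= snd (iter (2 * N) f y) ->
  c1 <= snd (iter N f y) -> snd (iter (S N) f y) <= c1 -> False.

(** The orbit crosses [c1] at some time [k] between [a] and [b]; the margins of [N] on both sides
    leave room to restart it at time [k - N], which produces a transit excluded by [no_transit]. *)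
Lemma no_long_transit a b c y :
  snd y <= c0 -> (N <= a)%nat -> (a <= b)%nat -> (b + N <= c)%nat ->
  c1 < snd (iter a f y) -> snd (iter b f y) < c1 -> c2 <= snd (iter c f y) -> False.
Proof.
  intros Hy Na ab bc Ha Hb Hc.
  destruct (crossing_time f c1 a b y) as (k & Hk & K1 & K2); trivial; [lra|].
  apply (no_transit (iter (k - N) f y)).
  - apply (descends_le f c0 0); trivial; lia.
  - rewrite <- iter_add. apply Rnot_lt_le; intros L.
    assert (snd (iter c f y) < c2); [|lra].
    apply (descends_lt f c2 (2 * N + (k - N))); trivial; [lia|lra].
  - rewrite <- iter_add. replace (N + (k - N))%nat with k by lia; trivial.
  - rewrite <- iter_add. replace (S N + (k - N))%nat with (S k) by lia; trivial.
Qed.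

Definition F2N (z : pt) : pt := iter (2 * N) f z.

(** Constraining the two extreme times is enough: by descent an orbit cannot rise back above [c0] or
    [c2], so the intermediate iterates lie in the band as well. *)
Definition slow (z : pt) : Prop := snd z <= c0 /\ c2 <= snd (F2N z).
Definition slow0 (z : pt) : Prop := slow z /\ c1 < snd (iter N f z).
Definition slow1 (z : pt) : Prop := slow z /\ snd (iter N f z) < c1.

Lemma F2N_iter n y : iter n f (F2N y) = iter (n + 2 * N) f y.
Proof. unfold F2N. now rewrite iter_add. Qed.

(** Being on Gamma_1 at the middle time is already a transit, because [desc1] puts the next iterate
    below. Hence a path in [slow] cannot pass from [slow0] to [slow1]. *)
Lemma slow_neq z : slow z -> snd (iter N f z) <> c1.
Proof.
  intros [H1 H2] E. apply (no_transit z); trivial; [lra|].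
  simpl. left; apply desc1; lra.
Qed.

(** The orbit of [y] would be above Gamma_1 at time [N], below it at time [3N + n], and not yet
    below Gamma_2 at time [4N + n], which is a long transit. The values 0 and 1 of [n] serve for
    images under [F2N] and under [f] after [F2N]. *)
Lemma slow1_not_image0 n y : (n <= 1)%nat -> slow1 (iter n f (F2N y)) -> slow0 y -> False.
Proof.
  intros Hn [[_ H1] H2] [[H3 _] H4]. unfold F2N at 1 in H1.
  rewrite F2N_iter, <- iter_add in H1, H2.
  apply (no_long_transit N (N + (n + 2 * N)) (2 * N + (n + 2 * N)) y); trivial; lia.
Qed.

Lemma slow0_not_image1 n y : slow0 (iter n f (F2N y)) -> slow1 y -> False.
Proof.
  intros [_ H2] [_ H4]. rewrite F2N_iter, <- iter_add in H2.
  assert (snd (iter (N + (n + 2 * N)) f y) <= c1); [|lra].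
  apply (descends_le f c1 N); trivial; [lia|lra].
Qed.

Lemma slow_not_both z : slow0 z -> slow1 z -> False.
Proof. intros [_ H] [_ H']; lra. Qed.

Lemma F2N_inj y y' : F2N y = F2N y' -> y = y'.
Proof.
  intros E. rewrite <- (iter_cancel f g (2 * N) y gf), <- (iter_cancel f g (2 * N) y' gf).
  unfold F2N in E. now rewrite E.
Qed.

Lemma f_inj y y' : f y = f y' -> y = y'.
Proof. intros E. rewrite <- (gf y), <- (gf y'). now rewrite E. Qed.

Lemma slow_bounds z : slow z -> c2 <= snd z <= c0.
Proof.
  intros [H1 H2]. split; trivial. apply Rnot_lt_le; intros L.
  assert (snd (F2N z) < c2); [|lra].
  apply (descends_lt f c2 0); trivial; [lia|simpl; lra].
Qed.

Lemma slow_image_bounds z : slow z -> c2 <= snd (F2N z) <= c0.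
Proof.
  intros [H1 H2]. split; trivial. apply (descends_le f c0 0); trivial; lia.
Qed.

(** The vertical segment from [F2N z] up to height [c0] is pulled back by the inverse of [F2N]. Its
    end has then height at least [c0] by descent, and the path is cut where it reaches Gamma_0. *)
Lemma conn_top z : slow z -> exists a, snd a = c0 /\ conn slow z a.
Proof.
  intros Hz. pose proof (slow_image_bounds z Hz) as Hb.
  assert (C : conn (fun w => c2 <= snd w) (F2N z) (fst (F2N z), c0)).
  { apply conn_segment. simpl. intros t Ht. nra. }
  apply (conn_map (iter (2 * N) g) _ (fun w => c2 <= snd (F2N w))) in C.
  - unfold F2N at 2 in C. rewrite iter_cancel in C by trivial.
    destruct (conn_first_hit (iter 0 f) _ _ _ 1 c0 (cont2_iter f 0 Hf) C) as (a & Ha & K).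
    + simpl. destruct Hz; lra.
    + simpl. apply Rnot_lt_le; intros L.
      pose proof (descends_lt f c0 0 (2 * N)
        (iter (2 * N) g (fst (F2N z), c0)) desc0) as Q.
      rewrite (iter_cancel g f) in Q by trivial. simpl in Q.
      assert (c0 < c0); [|lra]. apply Q; [lia|]. simpl; lra.
    + exists a; simpl in Ha; split; [lra|]. revert K; apply conn_weaken.
      intros w [h1 h2]; simpl in h2; split; trivial; lra.
  - now apply cont2_iter.
  - intros w Hw. unfold F2N. now rewrite iter_cancel.
Qed.

(** Dually, the vertical segment from [y] down to Gamma_2 is cut where its image under [F2N] reaches
    Gamma_2. *)
Lemma conn_bottom y : slow y -> exists b, snd (F2N b) = c2 /\ conn slow y b.
Proof.
  intros Hy. pose proof (slow_bounds y Hy) as Hb.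
  assert (C : conn (fun w => snd w <= c0) y (fst y, c2)).
  { apply conn_segment. simpl. intros t Ht. nra. }
  destruct (conn_first_hit (iter (2 * N) f) _ _ _ (-1) (- c2) (cont2_iter f _ Hf) C)
    as (a & Ha & K).
  - destruct Hy as [_ Hy]. unfold F2N in Hy; lra.
  - assert (snd (iter (2 * N) f (fst y, c2)) <= c2); [|lra].
    apply (descends_le f c2 0); trivial; [lia|simpl; lra].
  - exists a; split; [unfold F2N; lra|]. revert K; apply conn_weaken.
    intros w [h1 h2]; split; trivial. unfold F2N; lra.
Qed.

Lemma conn_slow0 z a : slow0 z -> conn slow z a -> conn slow0 z a.
Proof.
  intros [Hz Hz'] C. apply (conn_above (iter N f) _ _ _ c1) in C; trivial.
  - now apply cont2_iter.
  - exact slow_neq.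
Qed.

Lemma conn_slow1 z a : slow1 z -> conn slow z a -> conn slow1 z a.
Proof.
  intros [Hz Hz'] C. apply (conn_below (iter N f) _ _ _ c1) in C; trivial.
  - now apply cont2_iter.
  - exact slow_neq.
Qed.

(** The left-to-right order of the curves through [z] and [w], read on Gamma_0. Quantifying over all
    reachable endpoints makes it independent of chosen paths. *)
Definition left_top (z w : pt) : Prop := forall a b,
  snd a = c0 -> conn slow0 z a -> snd b = c0 -> conn slow1 w b -> fst a < fst b.

(** The order of the curves through [F2N y] and [F2N x], read on Gamma_2: their lower halves are
    images under [F2N] of paths in [slow]. *)
Definition left_bottom (y x : pt) : Prop := forall a b,
  snd (F2N a) = c2 -> conn slow0 y a -> snd (F2N b) = c2 -> conn slow1 x b ->
  fst (F2N a) < fst (F2N b).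

Lemma cont2_F2N : cont2 F2N.
Proof. apply (cont2_iter f (2 * N) Hf). Qed.

(** The curve from [F2N a] through [F2N y] to [p] lies in [slow0] and its image, the curve from
    [F2N b] through [F2N x] to [q] in [slow1] and its image. These sets are disjoint, while opposite
    orders at the two ends would force a crossing. *)
Lemma left_top_bottom y x :
  slow0 y -> slow0 (F2N y) -> slow1 x -> slow1 (F2N x) ->
  left_top (F2N y) (F2N x) -> left_bottom y x.
Proof.
  intros Hy Hz Hx Hw L a b Ha Ca Hb Cb.
  destruct (conn_top (F2N y)) as (p & Hp & Cp); [apply Hz|].
  destruct (conn_top (F2N x)) as (q & Hq & Cq); [apply Hw|].
  apply conn_slow0 in Cp; trivial. apply conn_slow1 in Cq; trivial.
  pose proof (L p q Hp Cp Hq Cq) as Lpq.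
  destruct (Rtotal_order (fst (F2N a)) (fst (F2N b))) as [|[E|G]]; trivial; exfalso.
  - assert (E' : a = b).
    { apply F2N_inj. rewrite (surjective_pairing (F2N a)), (surjective_pairing (F2N b)).
      congruence. }
    subst b. apply conn_end in Ca, Cb. exact (slow_not_both a Ca Cb).
  - destruct (conn_cross (fun z => slow1 z \/ exists v, z = F2N v /\ slow1 v)
       (fun z => slow0 z \/ exists v, z = F2N v /\ slow0 v)
       (F2N b) q (F2N a) p) as (z & [Z1|(v & -> & Z1)] & [Z2|(v' & Ev & Z2)]); trivial.
    + apply conn_trans with (F2N x).
      * apply conn_sym. revert Cb; apply conn_map; [apply cont2_F2N|]. eauto.
      * revert Cq; apply conn_weaken; auto.
    + apply conn_trans with (F2N y).
      * apply conn_sym. revert Ca; apply conn_map; [apply cont2_F2N|]. eauto.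
      * revert Cp; apply conn_weaken; auto.
    + intros z [Z|(v & -> & Z)]; right; rewrite Ha.
      * apply slow_bounds, Z.
      * apply slow_image_bounds, Z.
    + intros z [Z|(v & -> & Z)]; right; rewrite Hq.
      * apply slow_bounds, Z.
      * apply slow_image_bounds, Z.
    + intros z [Z|(v & -> & Z)]; right; rewrite Hb.
      * apply slow_bounds, Z.
      * apply slow_image_bounds, Z.
    + intros z [Z|(v & -> & Z)]; rewrite Hp.
      * apply slow_bounds, Z.
      * apply slow_image_bounds, Z.
    + exact (slow_not_both z Z2 Z1).
    + subst z. exact (slow1_not_image0 0 v' (Nat.le_succ_diag_r 0) Z1 Z2).
    + exact (slow0_not_image1 0 v Z2 Z1).
    + apply F2N_inj in Ev; subst v'. exact (slow_not_both v Z2 Z1).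
Qed.

(* The paths below [f (F2N y)] and [f (F2N x)] are prolonged by half-lines of the
   curve [f (Gamma_2)] going to the left, respectively to the right. *)
Lemma left_bottom_top y x :
  slow0 y -> slow1 x -> left_bottom y x -> left_top (f (F2N y)) (f (F2N x)).
Proof.
  intros Hy Hx L p q Hp Cp Hq Cq.
  destruct (conn_bottom y) as (a & Ha & Ca); [apply Hy|].
  destruct (conn_bottom x) as (b & Hb & Cb); [apply Hx|].
  apply conn_slow0 in Ca; trivial. apply conn_slow1 in Cb; trivial.
  pose proof (L a b Ha Ca Hb Cb) as Lab.
  destruct (Rtotal_order (fst p) (fst q)) as [|[E|G]]; trivial; exfalso.
  { assert (E' : p = q).
    { rewrite (surjective_pairing p), (surjective_pairing q). congruence. }
    subst q. apply conn_end in Cp, Cq. exact (slow_not_both p Cp Cq). }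
  destruct (band_bound f c2 c2 Hf HT) as [B HB].
  assert (HB' : forall t, Rabs (fst (f (t, c2)) - t) <= B).
  { intros t. destruct (HB (t, c2)) as [h _]; [simpl; lra|exact h]. }
  assert (cont2_fF : cont2 (fun z => f (F2N z))) by apply (cont2_iter f (S (2 * N)) Hf).
  assert (Ma : conn (fun z => exists v, z = f (F2N v) /\ conn slow0 y v)
                 (f (F2N y)) (f (F2N a))).
  { apply (conn_map (fun z => f (F2N z)) (fun v => conn slow0 y v)); trivial.
    - eauto.
    - now apply conn_prefix. }
  assert (Mb : conn (fun z => exists v, z = f (F2N v) /\ conn slow1 x v)
                 (f (F2N x)) (f (F2N b))).
  { apply (conn_map (fun z => f (F2N z)) (fun v => conn slow1 x v)); trivial.
    - eauto.
    - now apply conn_prefix. }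
  destruct (conn_bounded _ _ _ Ma) as (B1 & P1 & Ma').
  destruct (conn_bounded _ _ _ Mb) as (B2 & P2 & Mb').
  destruct (conn_bounded _ _ _ Cp) as (B3 & P3 & Cp').
  destruct (conn_bounded _ _ _ Cq) as (B4 & P4 & Cq').
  assert (P5 : 0 <= B).
  { pose proof (HB' 0). pose proof (Rabs_pos (fst (f (0, c2)) - 0)). lra. }
  set (ta := fst (F2N a)) in *. set (tb := fst (F2N b)) in *.
  assert (Ea : F2N a = (ta, c2)) by (rewrite (surjective_pairing (F2N a)); fold ta; congruence).
  assert (Eb : F2N b = (tb, c2)) by (rewrite (surjective_pairing (F2N b)); fold tb; congruence).
  (* Large enough for [f (K, c2)] to lie at distance at least 1 to the right of [PX], and
     [f (- K, c2)] likewise to the left of [PY]. *)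
  set (K := B1 + B2 + B3 + B4 + 2 * B + Rabs ta + Rabs tb + 1).
  pose proof (Rle_abs ta). pose proof (Rle_abs (- ta)).
  pose proof (Rle_abs tb). pose proof (Rle_abs (- tb)).
  pose proof (Rabs_pos ta). pose proof (Rabs_pos tb).
  rewrite !Rabs_Ropp in *.
  pose proof (HB' K) as BK. pose proof (HB' (- K)) as BK'.
  apply Rabs_le_bounds in BK, BK'.
  set (PX := fun z => (slow0 z /\ Rabs (fst z) <= B3) \/
     ((exists v, z = f (F2N v) /\ conn slow0 y v) /\ Rabs (fst z) <= B1) \/
     (exists t, t <= ta /\ z = f (t, c2))).
  set (PY := fun z => (slow1 z /\ Rabs (fst z) <= B4) \/
     ((exists v, z = f (F2N v) /\ conn slow1 x v) /\ Rabs (fst z) <= B2) \/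
     (exists t, tb <= t /\ z = f (t, c2))).
  assert (HX : forall z, PX z -> fst z <= fst (f (K, c2)) - 1 /\ snd z <= c0).
  { intros z [[Z1 Z2]|[[(v & Ev & Z1) Z2]|(t & Ht & ->)]].
    - apply Rabs_le_bounds in Z2. split; [unfold K in *; lra|apply Z1].
    - apply Rabs_le_bounds in Z2. split; [unfold K in *; lra|]. subst z.
      apply conn_end in Z1. left; apply desc0, slow_image_bounds, Z1.
    - specialize (HB' t). apply Rabs_le_bounds in HB'. split; [unfold K in *; lra|].
      left; apply desc0; simpl; lra. }
  assert (HY : forall z, PY z -> fst (f (- K, c2)) <= fst z - 1 /\ snd z <= c0).
  { intros z [[Z1 Z2]|[[(v & Ev & Z1) Z2]|(t & Ht & ->)]].
    - apply Rabs_le_bounds in Z2. split; [unfold K in *; lra|apply Z1].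
    - apply Rabs_le_bounds in Z2. split; [unfold K in *; lra|]. subst z.
      apply conn_end in Z1. left; apply desc0, slow_image_bounds, Z1.
    - specialize (HB' t). apply Rabs_le_bounds in HB'. split; [unfold K in *; lra|].
      left; apply desc0; simpl; lra. }
  assert (below2 : forall t, snd (f (t, c2)) < c2) by (intros t; apply desc2; simpl; lra).
  destruct (conn_cross PX PY (f (- K, c2)) p (f (K, c2)) q) as (z & ZX & ZY); trivial.
  - apply conn_trans with (f (F2N y)); [apply conn_trans with (f (F2N a))|].
    + rewrite Ea. apply (conn_map f (fun z => fst z <= ta /\ snd z = c2)); trivial.
      * intros [t c] [h1 h2]; simpl in h1, h2; subst c. right; right; eauto.
      * apply conn_segment. intros t Ht; simpl. unfold K; split; nra.
    + apply conn_sym. revert Ma'; apply conn_weaken. unfold PX; auto.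
    + revert Cp'; apply conn_weaken. unfold PX; auto.
  - apply conn_trans with (f (F2N x)); [apply conn_trans with (f (F2N b))|].
    + rewrite Eb. apply (conn_map f (fun z => tb <= fst z /\ snd z = c2)); trivial.
      * intros [t c] [h1 h2]; simpl in h1, h2; subst c. right; right; eauto.
      * apply conn_segment. intros t Ht; simpl. unfold K; split; nra.
    + apply conn_sym. revert Mb'; apply conn_weaken. unfold PY; auto.
    + revert Cq'; apply conn_weaken. unfold PY; auto.
  - unfold K in *; lra.
  - intros z Z; left; now apply HX.
  - intros z Z; right; rewrite Hp; now apply HY.
  - intros z Z; left; now apply HY.
  - intros z Z; rewrite Hq; now apply HX.
  - destruct ZX as [[Z1 _]|[[(v & Ev & Z1) _]|(t & Ht & Et)]],
      ZY as [[Z2 _]|[[(v' & Ev' & Z2) _]|(t' & Ht' & Et')]].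
    + exact (slow_not_both z Z1 Z2).
    + subst z. apply conn_end in Z2. exact (slow0_not_image1 1 v' Z1 Z2).
    + subst z. destruct Z1 as [Z1 _]. apply slow_bounds in Z1. specialize (below2 t'); lra.
    + subst z. apply conn_end in Z1. exact (slow1_not_image0 1 v (Nat.le_refl 1) Z2 Z1).
    + rewrite Ev in Ev'. apply f_inj, F2N_inj in Ev'. subst v'.
      apply conn_end in Z1, Z2. exact (slow_not_both v Z1 Z2).
    + rewrite Ev in Et'. apply f_inj in Et'.
      assert (Q := L v b ltac:(now rewrite Et') Z1 Hb Cb).
      rewrite Et' in Q; simpl in Q. fold tb in Q. lra.
    + subst z. destruct Z2 as [Z2 _]. apply slow_bounds in Z2. specialize (below2 t); lra.
    + rewrite Et in Ev'. apply f_inj in Ev'. symmetry in Ev'.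
      assert (Q := L a v' Ha Ca ltac:(now rewrite Ev') Z2).
      rewrite Ev' in Q; simpl in Q. fold ta in Q. lra.
    + rewrite Et in Et'. apply f_inj in Et'. injection Et' as Et'. lra.
Qed.

(* Translates of a path from [Gamma_0] to below [Gamma_2] which avoids [slow] act as
   barriers. *)
Lemma slow_width :
  (exists x, snd (f (x, c0)) = c2) ->
  exists W, forall z a, conn slow z a -> Rabs (fst a - fst z) <= W.
Proof.
  intros [x Hx].
  (* The images of [b] and [e] under [F2N] are both strictly below Gamma_2. The segment joining
     them, pulled back, is a path from [e] to [b] that avoids [slow]. *)
  set (b := (x, c0)). set (e := (0, c2 - 1)).
  assert (Hb : snd (F2N b) < c2).
  { apply (descends_lt f c2 1); trivial; [lia|]. simpl; unfold b; lra. }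
  assert (He : snd (F2N e) < c2).
  { apply (descends_lt f c2 0); trivial; [lia|]. simpl; lra. }
  assert (C : conn (fun z => snd z < c2) (F2N e) (F2N b)).
  { apply conn_segment; simpl. intros t Ht. destruct (Rle_or_lt t (1/2)); nra. }
  apply (conn_map (iter (2 * N) g) _ (fun w => snd (F2N w) < c2)) in C.
  2:{ now apply cont2_iter. }
  2:{ intros w Hw. unfold F2N. now rewrite iter_cancel. }
  unfold F2N at 2 3 in C. rewrite !iter_cancel in C by trivial.
  destruct (conn_bounded _ _ _ C) as (B & _ & CB).
  assert (Wide : forall z a, conn slow z a -> fst a <= fst z + 2 * B + 3).
  { intros z a Cza. apply Rnot_lt_le; intros L.
    (* The barrier translated by [k] lies more than 1 to the right of [z] and more than 1 to the
       left of [a]. *)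
    set (k := up (fst z + B + 1)).
    destruct (archimed (fst z + B + 1)) as [k1 k2]. fold k in k1, k2.
    destruct (conn_cross slow (fun w => snd (F2N w) < c2 /\ Rabs (fst w - IZR k) <= B)
      z a (shift k e) (shift k b)) as (w & [_ Z1] & [Z2 _]); trivial.
    - apply (conn_map (shift k) _ _ e b (cont2_shift k)) with (2 := CB).
      intros w [h1 h2]. unfold F2N. rewrite shift_iter by trivial. split; [exact h1|].
      unfold shift; simpl. now replace (fst w + IZR k - IZR k) with (fst w) by ring.
    - apply conn_start in CB. destruct CB as [_ h]. apply Rabs_le_bounds in h.
      unfold shift; simpl. unfold e in h; simpl in *; lra.
    - apply conn_end in CB. destruct CB as [_ h]. apply Rabs_le_bounds in h.
      unfold shift; simpl. unfold b in h; simpl in *; lra.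
    - intros w Hw; right. apply slow_bounds in Hw. simpl; lra.
    - intros w [_ h]; left. apply Rabs_le_bounds in h; lra.
    - intros w [_ h]; left. apply Rabs_le_bounds in h; lra.
    - intros w [Hw _]. simpl; lra.
    - lra. }
  exists (2 * B + 3). intros z a Cza.
  pose proof (Wide z a Cza). apply conn_sym in Cza. pose proof (Wide a z Cza).
  apply Rabs_le; lra.
Qed.

Lemma no_transit_absurd p q d m :
  (exists x, snd (f (x, c0)) = c2) ->
  (forall n, c1 <= snd (iter n f p) <= c0) ->
  (forall n, c2 <= snd (iter n f q) <= c1) ->
  0 < d ->
  (forall n, (m <= n)%nat -> d * INR n <= fst (iter n f p) - fst p) ->
  (forall n, (m <= n)%nat -> d * INR n <= fst q - fst (iter n f q)) ->
  False.
Proof.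
  intros H2 Hp Hq Hd Dp Dq.
  destruct (slow_width H2) as [W HW].
  (* Since [k] exceeds the initial gap plus two widths, every endpoint reachable from [F2N p] on
     Gamma_0 is to the left of every one reachable from [F2N q']. *)
  set (k := up (Rabs (fst (F2N p) - fst (F2N q)) + 2 * W)).
  destruct (archimed (Rabs (fst (F2N p) - fst (F2N q)) + 2 * W)) as [k1 k2]. fold k in k1, k2.
  set (q' := shift k q).
  assert (Hq' : forall n, c2 <= snd (iter n f q') <= c1).
  { intros n. unfold q'. rewrite shift_iter by trivial. apply Hq. }
  assert (Sp : forall n, slow0 (iter n f p)).
  { intros n. assert (S : slow (iter n f p)).
    { split; [apply Hp|]. unfold F2N. rewrite <- iter_add.
      specialize (Hp (2 * N + n)%nat); lra. }
    split; trivial. pose proof (slow_neq _ S) as Ne. rewrite <- iter_add in *.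
    specialize (Hp (N + n)%nat); lra. }
  assert (Sq : forall n, slow1 (iter n f q')).
  { intros n. assert (S : slow (iter n f q')).
    { split; [specialize (Hq' n); lra|]. unfold F2N. rewrite <- iter_add. apply Hq'. }
    split; trivial. pose proof (slow_neq _ S) as Ne. rewrite <- iter_add in *.
    specialize (Hq' (N + n)%nat); lra. }
  assert (L : forall n, left_top (F2N (iter n f p)) (F2N (iter n f q'))).
  { assert (FF : forall n z, F2N (iter n f z) = iter (2 * N + n) f z)
      by (intros; unfold F2N; now rewrite iter_add).
    induction n as [|n IH].
    - intros a b Ha Ca Hb Cb. simpl in Ca, Cb.
      apply (conn_weaken _ slow) in Ca; [|intros ? []; trivial].
      apply (conn_weaken _ slow) in Cb; [|intros ? []; trivial].
      apply HW, Rabs_le_bounds in Ca, Cb.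
      assert (Eq : fst (F2N q') = fst (F2N q) + IZR k).
      { unfold F2N, q'. now rewrite shift_iter. }
      pose proof (Rle_abs (fst (F2N p) - fst (F2N q))). lra.
    - assert (SS : forall z, F2N (iter (S n) f z) = f (F2N (iter n f z))).
      { intros z. rewrite !FF. replace (2 * N + S n)%nat with (S (2 * N + n)) by lia.
        reflexivity. }
      rewrite !SS. apply left_bottom_top; auto. apply left_top_bottom; auto;
        rewrite FF; auto. }
  (* After this time the drift exceeds the initial distance to [q'] plus the widths of the two upper
     paths, so their endpoints on Gamma_0 are in the wrong order. *)
  destruct (INR_unbounded ((2 * W + IZR k + Rabs (fst q - fst p)) / d)) as [n0 Hn0].
  set (n := (n0 + m)%nat).
  assert (Hn : 2 * W + IZR k + Rabs (fst q - fst p) < d * INR (2 * N + n)).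
  { assert (INR n0 <= INR (2 * N + n)) by (apply le_INR; unfold n; lia).
    apply Rlt_le_trans with (d * INR n0); [|nra].
    apply Rmult_lt_reg_r with (/ d); [now apply Rinv_0_lt_compat|].
    replace (d * INR n0 * / d) with (INR n0) by (field; lra). exact Hn0. }
  assert (d0 : 0 <= d * INR (2 * N + n)).
  { pose proof (pos_INR (2 * N + n)). nra. }
  destruct (conn_top (F2N (iter n f p))) as (a & Ha & Ca).
  { unfold F2N. rewrite <- iter_add. apply Sp. }
  destruct (conn_top (F2N (iter n f q'))) as (b & Hb & Cb).
  { unfold F2N. rewrite <- iter_add. apply Sq. }
  pose proof (HW _ _ Ca) as Wa. pose proof (HW _ _ Cb) as Wb.
  apply Rabs_le_bounds in Wa, Wb.
  apply conn_slow0 in Ca; [|unfold F2N; rewrite <- iter_add; apply Sp].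
  apply conn_slow1 in Cb; [|unfold F2N; rewrite <- iter_add; apply Sq].
  pose proof (L n a b Ha Ca Hb Cb) as Lab.
  unfold F2N in Wa, Wb. rewrite <- iter_add in Wa, Wb.
  assert (Eq : fst (iter (2 * N + n) f q') = fst (iter (2 * N + n) f q) + IZR k).
  { unfold q'. now rewrite shift_iter. }
  specialize (Dp (2 * N + n)%nat ltac:(unfold n; lia)).
  specialize (Dq (2 * N + n)%nat ltac:(unfold n; lia)).
  pose proof (Rle_abs (fst q - fst p)). lra.
Qed.
End NoTransit.

(** * Connecting orbits *)

(** If [z] is not above the line and [f z] is not below it, the segment from [f z] to [z0] stays at
    height at least [r], while its preimage meets the line; this contradicts the condition on the
    line. The point [z0] excludes that [f] exchanges the two sides. *)
Lemma descends_of_line f g r z0 :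
  cont2 g -> (forall p, g (f p) = p) -> (forall p, f (g p) = p) ->
  (forall x, snd (f (x, r)) < r) -> r <= snd z0 -> r <= snd (g z0) -> descends f r.
Proof.
  intros Hg gf fg Hr H1 H2 z Hz. apply Rnot_le_lt; intros L.
  destruct (conn_level g (fun w => r <= snd w) (f z) z0 r Hg) as (w & W1 & W2).
  - apply conn_segment; simpl. intros t Ht. nra.
  - rewrite gf. nra.
  - specialize (Hr (fst (g w))).
    rewrite <- W2, <- surjective_pairing, fg in Hr at 1. lra.
Qed.

(** Longer and longer transits, recentred at their middle time and translated to abscissas between 0
    and 1, have a cluster point. Each constraint is closed and holds from some index on, so it
    passes to that point. Half-length [S N] covers the [N + 1] future iterates required. *)
Lemma connecting_orbit f g c0 c1 c2 :
  cont2 f -> cont2 g -> (forall p, g (f p) = p) -> (forall p, f (g p) = p) ->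
  commutes_with_T f -> descends f c0 -> descends f c1 -> descends f c2 ->
  (forall N, (1 <= N)%nat -> exists y, snd y <= c0 /\ c2 <= snd (iter (2 * N) f y) /\
     c1 <= snd (iter N f y) /\ snd (iter (S N) f y) <= c1) ->
  exists z, (forall k, c1 <= snd (iter k g z) <= c0) /\
            (forall k, c2 <= snd (iter (S k) f z) <= c1).
Proof.
  intros Hf Hg gf fg HT d0 d1 d2 H.
  assert (HTg := inverse_commutes f g gf fg HT).
  destruct (choice _ _ (fun (N : nat) v => 0 <= fst v <= 1 /\
     (forall k, (k <= N)%nat -> c1 <= snd (iter k g v) <= c0) /\
     (forall k, (k <= N)%nat -> c2 <= snd (iter (S k) f v) <= c1))) as [v Hv].
  { intros N. destruct (H (S N)) as (y & h1 & h2 & h3 & h4); [lia|].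
    destruct (shift_into_unit (iter (S N) f y)) as [l Hl].
    exists (shift l (iter (S N) f y)). split; trivial. split; intros k Hk;
      rewrite shift_iter by trivial; change (snd (shift l ?w)) with (snd w).
    - rewrite iter_cancel_le by (trivial; lia). split.
      + apply Rnot_lt_le; intros L.
        destruct (Nat.eq_dec k 0) as [->|Hk0]; [rewrite Nat.sub_0_r in L; lra|].
        pose proof (descends_lt f c1 (S N - k) (S N) y d1) as Q.
        assert (snd (iter (S N) f y) < c1); [apply Q; [lia|lra]|lra].
      + apply (descends_le f c0 0); trivial; lia.
    - rewrite <- iter_add. split.
      + apply Rnot_lt_le; intros L.
        destruct (Nat.eq_dec k N) as [->|Hk0].
        * replace (S N + S N)%nat with (2 * S N)%nat in L by lia. lra.
        * pose proof (descends_lt f c2 (S k + S N) (2 * S N) y d2) as Q'.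
          assert (snd (iter (2 * S N) f y) < c2); [apply Q'; [lia|lra]|lra].
      + apply (descends_le f c1 (S (S N))); trivial; lia. }
  destruct (rectangle_adherent v 0 1 c1 c0) as (z & _ & _ & Hz).
  { intros n; apply Hv. }
  { intros n. destruct (Hv n) as (_ & h & _). apply (h 0%nat); lia. }
  exists z; split; intros k; apply (adherent_band _ v z _ _ k); trivial;
    try (now apply cont2_iter); intros n Hn; now apply Hv.
Qed.

Theorem mainTheorem13 (f : pt -> pt) (c0 c1 c2 : R) :
  homeo f -> isotopic_to_id f -> commutes_with_T f ->
  (* (H1): Gamma_j = {y = c_j}, Gamma0 above Gamma1 above Gamma2,
           f(Gamma_j) in the open half-plane below Gamma_j *)
  c1 < c0 -> c2 < c1 ->
  (forall x, snd (f (x, c0)) < c0) ->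
  (forall x, snd (f (x, c1)) < c1) ->
  (forall x, snd (f (x, c2)) < c2) ->
  (* (H2) *)
  (forall n : nat, (1 <= n)%nat -> exists x, snd (iter n f (x, c0)) = c2) ->
  (* (H3): A0 = band between Gamma1 and Gamma0, A1 = band between Gamma2 and Gamma1 *)
  (exists z, Theta f (band c1 c0) z) ->
  (exists z, Theta f (band c2 c1) z) ->
  (forall x, rho_in f (Theta f (band c1 c0)) x -> exists r, x = Fin r /\ 0 < r) ->
  (forall x, rho_in f (Theta f (band c2 c1)) x -> exists r, x = Fin r /\ r < 0) ->
  rho_in f (Theta f (fun p => band c1 c0 p \/ band c2 c1 p)) (Fin 0).
Proof.
  intros (Hf & g & Hg & gf & fg) _ HT c10 c21 l0 l1 l2 H2 [p Hp] [q Hq] R0 R1.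
  assert (Bp : forall n, c1 <= snd (iter n f p) <= c0) by apply Hp.
  assert (Bq : forall n, c2 <= snd (iter n f q) <= c1) by apply Hq.
  (* The orbit of [p] stays above Gamma_1, so [f p] and its preimage certify the side; the orbit of
     [q] does the same for Gamma_2. *)
  assert (d1 : descends f c1).
  { apply (descends_of_line f g c1 (f p)); trivial; [apply (Bp 1%nat)|].
    rewrite gf; apply (Bp 0%nat). }
  assert (d2 : descends f c2).
  { apply (descends_of_line f g c2 (f q)); trivial; [apply (Bq 1%nat)|].
    rewrite gf; apply (Bq 0%nat). }
  (* Otherwise [g] would squeeze the whole half-plane above [Gamma_0] into a band,
     whose image by [f] has bounded height. *)
  assert (d0 : descends f c0).
  { destruct (band_bound f c1 c0 Hf HT) as [B HB].
    set (z := (0, Rmax c0 (B + 1))).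
    pose proof (Rmax_l c0 (B + 1)). pose proof (Rmax_r c0 (B + 1)).
    apply (descends_of_line f g c0 z); trivial.
    apply Rnot_lt_le; intros L.
    destruct (HB (g z)) as [_ h].
    - split; [|lra]. apply Rnot_lt_le; intros L'.
      assert (snd (f (g z)) < c1) by (apply d1; lra).
      rewrite fg in H1; unfold z in H1; simpl in H1; lra.
    - rewrite fg in h. apply Rabs_le_bounds in h. unfold z in h; simpl in h; lra. }
  destruct (classic (forall N, (1 <= N)%nat -> exists y, snd y <= c0 /\
     c2 <= snd (iter (2 * N) f y) /\
     c1 <= snd (iter N f y) /\ snd (iter (S N) f y) <= c1)) as [HN|HN].
  - destruct (connecting_orbit f g c0 c1 c2) as (z & Z1 & Z2); trivial.
    apply (connecting_orbit_zero f g) with (z := z); trivial; lra.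
  - exfalso. apply not_all_ex_not in HN. destruct HN as [N HN].
    apply imply_to_and in HN. destruct HN as [N1 HN].
    destruct (band_bound f c2 c0 Hf HT) as [B HB].
    destruct (uniform_drift f (Theta f (band c1 c0)) B 1) as (d & m & Hd & D); auto.
    { intros w Hw n. now apply (Theta_iter f g). }
    { intros w [Hw _]. apply HB. unfold band in Hw; lra. }
    { intros x Hx. destruct (R0 x Hx) as (r & -> & Hr). exists r; split; trivial; lra. }
    destruct (uniform_drift f (Theta f (band c2 c1)) B (-1)) as (d' & m' & Hd' & D'); auto.
    { intros w Hw n. now apply (Theta_iter f g). }
    { intros w [Hw _]. apply HB. unfold band in Hw; lra. }
    { intros x Hx. destruct (R1 x Hx) as (r & -> & Hr). exists r; split; trivial; lra. }
    apply (no_transit_absurd f g Hf Hg gf fg HT c0 c1 c2 c10 c21 d0 d1 d2 N N1)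
      with (p := p) (q := q) (d := Rmin d d') (m := max m m'); trivial.
    + intros y h1 h2 h3 h4. apply HN. exists y; auto.
    + exact (H2 1%nat (Nat.le_refl 1)).
    + now apply Rmin_glb_lt.
    + intros n Hn. assert (Hn' : (m <= n)%nat) by lia. specialize (D n p Hn' Hp).
      pose proof (Rmin_l d d'). pose proof (pos_INR n). nra.
    + intros n Hn. assert (Hn' : (m' <= n)%nat) by lia. specialize (D' n q Hn' Hq).
      pose proof (Rmin_r d d'). pose proof (pos_INR n). nra.
Qed.
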